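(* Let $\mathcal A$ be a countable algebra of subsets of a set $T$, and let $(\mathcal F_A)_{A\in\mathcal A}$ be a family of sub-$\sigma$-fields on a probability space $(\Omega,\mathcal F,P)$ such that for all disjoint $A,B\in\mathcal A$ the $\sigma$-fields $\mathcal F_A,\mathcal F_B$ are independent and together generate $\mathcal F_{A\cup B}$. Assume that for every increasing sequence $A_1\subset A_2\subset\cdots$ of elements of $\mathcal A$, the $\sigma$-field generated by the two (independent) $\sigma$-fields $\bigvee_k\mathcal F_{A_k}$ and $\bigcap_k\mathcal F_{T\setminus A_k}$ is the whole $\mathcal F_T$. Then $\mathcal F_T=\mathcal F_{\text{stable}}$.
   Context: All sub-$\sigma$-fields are understood modulo null sets: every sub-$\sigma$-field contains all $P$-null sets of $\mathcal F$, and generated $\sigma$-fields are understood to include them. $\bigvee_k\mathcal F_{A_k}$ is the least $\sigma$-field containing all $\mathcal F_{A_k}$. $L_2(\mathcal G)$ denotes the real Hilbert space $L_2(\Omega,\mathcal G,P)$. For $A\in\mathcal A$, $E_A:L_2(\mathcal F_T)\to L_2(\mathcal F_T)$ is $E_A X=\mathbb E(X\mid\mathcal F_A)$. For a finite subalgebra $\mathcal B\subset\mathcal A$ with atoms $a_1,\dots,a_r$ and $p\in[0,1]$, let $\mu_p^{\mathcal B}$ be the probability measure on the finite set $\mathcal B$ assigning to $A=a_{k_1}\cup\dots\cup a_{k_n}$ ($k_1<\dots<k_n$) the mass $p^n(1-p)^{r-n}$. Choose finite subalgebras $\mathcal A_1\subset\mathcal A_2\subset\cdots$ with $\bigcup_m\mathcal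 A_m=\mathcal A$; for $t\ge0$ put $U_t^{(m)}=\sum_{A\in\mathcal A_m}\mu_{e^{-t}}^{\mathcal A_m}(A)\,E_A$ on $L_2(\mathcal F_T)$. The strong limit $U_t=\lim_{m\to\infty}U_t^{(m)}$ exists, does not depend on the choice of $(\mathcal A_m)$, and satisfies $U_sU_t=U_{s+t}$, $\|U_t\|\le1$. $\mathcal F_{\text{stable}}\subset\mathcal F_T$ is the sub-$\sigma$-field such that, for $X\in L_2(\mathcal F_T)$: $X\in L_2(\mathcal F_{\text{stable}})$ if and only if $\|X-U_tX\|\to0$ as $t\to0$ (it is the $\sigma$-field generated by all such $X$). *)

(* Defs.v *)
From HB Require Import structures.
From mathcomp Require Import all_boot all_order all_algebra finmap.
From mathcomp Require Import all_classical all_reals all_analysis.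

Set Implicit Arguments.
Unset Strict Implicit.
Unset Printing Implicit Defensive.

Import Order.TTheory GRing.Theory Num.Theory.
Import numFieldNormedType.Exports.

Local Open Scope classical_set_scope.
Local Open Scope ring_scope.

Section SetAlgebras.
Context {T : Type}.
Implicit Types (B : set (set T)) (A : set T).

Definition set_algebra B := [/\ B set0, setU_closed B & setC_closed B].

Definition finite_subalgebra B (Alg : set (set T)) :=
  [/\ set_algebra B, finite_set B & B `<=` Alg].

Definition exhaustion (AA : nat -> set (set T)) (Alg : set (set T)) :=
  [/\ forall m, finite_subalgebra (AA m) Alg,
      forall m, AA m `<=` AA m.+1 &
      \bigcup_m AA m = Alg].

Definition atoms B : set (set T) :=
  [set a | [/\ B a, a !=set0 &
               forall b, B b -> b `<=` a -> b = set0 \/ b = a]].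

(* For a finite algebra B with r atoms and A in B the union of n of them:
   natoms B A = n and natoms B setT = r. *)
Definition natoms B A : nat := #|` fset_set [set a | atoms B a /\ a `<=` A] |.

Definition atom_mass {R : realType} B (p : R) A : R :=
  p ^+ natoms B A * (1 - p) ^+ (natoms B setT - natoms B A).

End SetAlgebras.

Section SubSigmaFields.
Context {d : measure_display} {Om : measurableType d} {R : realType}.
Variable P : probability Om R.
Implicit Types (G H : set (set Om)) (X Y : Om -> R).

Definition null_sets : set (set Om) :=
  [set N | measurable N /\ P N = 0%E].

Definition sub_sigma_field G :=
  [/\ sigma_algebra setT G, G `<=` measurable & null_sets `<=` G].

Definition generated (S : set (set Om)) : set (set Om) :=
  <<s S `|` null_sets >>.

Definition independent G H :=
  forall a b, G a -> H b -> P (a `&` b) = (P a * P b)%E.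

Definition field_measurable G X := g_sigma_algebra_preimage X `<=` G.

(* L_2(G), before identification of almost everywhere equal functions *)
Definition L2 G : set (Om -> R) :=
  [set X | X \in Lfun P 2%:E /\ field_measurable G X].

Definition L2norm X : \bar R := 'N[P]_2%:E[EFin \o X].

Definition is_cond_exp G X Y :=
  [/\ field_measurable G Y,
      P.-integrable setT (EFin \o Y) &
      forall B, G B ->
        (\int[P]_(w in B) (Y w)%:E = \int[P]_(w in B) (X w)%:E)%E].

(* A version of E(X | G); it exists and is unique up to null sets for X
   integrable and G a sub-sigma-field. *)
Definition cond_exp G X : Om -> R := xget (cst 0) [set Y | is_cond_exp G X Y].

End SubSigmaFields.

Section Stability.
Context {T : Type} {d : measure_display} {Om : measurableType d} {R : realType}.
Variable P : probability Om R.
Variable F : set T -> set (set Om).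
Variable AA : nat -> set (set T).
Implicit Types (X : Om -> R) (t : R).

Definition Uapprox m t X : Om -> R := fun w =>
  \sum_(A \in AA m) atom_mass (AA m) (expR (- t)) A * cond_exp P (F A) X w.

(* A version of the strong limit of Uapprox m t X as m tends to infinity. *)
Definition Ulim t X : Om -> R :=
  xget (cst 0) [set Y | L2 P (F setT) Y /\
    L2norm P (fun w => Uapprox m t X w - Y w) @[m --> \oo] --> 0%E].

Definition stable : set (Om -> R) :=
  [set X | L2 P (F setT) X /\
    L2norm P (fun w => X w - Ulim t X w) @[t --> 0^'+] --> 0%E].

Definition stable_field : set (set Om) :=
  generated P (\bigcup_(X in stable) g_sigma_algebra_preimage X).

End Stability.

(* Main.v *)
(* For an event a of F_T put f(A) = E[P(a | F_A)^2].  Since the projections E_A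
   commute and E_A E_B = E_(A :&: B), f(A) is the mass that the spectral measure of
   the indicator X of a gives to the random closed sets M contained in A; on a
   finite subalgebra this reads f(A) = sum_(S <= A) w(S) with w >= 0, and
   <U_t^(m) X, X> = sum_S w(S) e^(-t |S|).  So ||X - U_t^(m) X||^2 is at most the
   probability that M meets the union of the atoms of A_m omitted at random, each
   with probability 1 - e^(-t), and X is stable once this tends to 0 as t -> 0,
   uniformly in m.

   Otherwise M is infinite with positive probability.  A sparse random union C of
   atoms of a fine partition then hits M with probability bounded below, while M
   remains infinite outside C up to an arbitrarily small loss of probability: a
   point of M is lost only if its atom is chosen.  Iterating gives increasing sets
   A_k such that M meets A_(k+1) \ A_k with probability at least some delta > 0,
   for every k.  The continuity assumption forbids this: it makes a approximable
   by events of F_(A_k) \/ F_(T \ A_n), uniformly in n >= k, whence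
   f(T) - f(A_k :|: ~: A_n), the probability that M meets A_n \ A_k, is small. *)

Require Import Defs.
From HB Require Import structures.
From mathcomp Require Import all_boot all_order all_algebra finmap.
From mathcomp Require Import all_classical all_reals all_analysis.
From mathcomp Require Import measurable_realfun ring lra.

Set Implicit Arguments.
Unset Strict Implicit.
Unset Printing Implicit Defensive.

Import Order.TTheory GRing.Theory Num.Theory.
Import numFieldNormedType.Exports.

Local Open Scope classical_set_scope.
Local Open Scope ring_scope.

(** * Sums over subsets of a finite set *)

Section SubsetSums.
Context {R : comNzRingType} {K : finType}.
Implicit Types (I J S : {set K}) (F : {set K} -> R).

(** This is the chance that a random subset, keeping each point independently with probability [p],
    contains [J]; the sum is an expanded product over the points. *)
Lemma sum_bernoulli_superset (p : R) J :
  \sum_(I : {set K} | J \subset I) p ^+ #|I| * (1 - p) ^+ (#|K| - #|I|) =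
  p ^+ #|J|.
Proof.
transitivity (\prod_(i : K) (p + (if i \in J then 0 else 1 - p))).
  rewrite bigA_distr big_mkcond /=; apply: eq_bigr => I _; case: ifPn => JI.
    have <- : #|~: I| = (#|K| - #|I|)%N by rewrite cardsCs finset.setCK.
    rewrite (bigID (mem I)) /=; congr (_ * _).
      by rewrite -prodr_const; apply: eq_bigr => i ->.
    rewrite -prodr_const; apply: eq_big => i; first by rewrite inE.
    rewrite inE => /negbTE iI; rewrite iI ifN //; apply/negP => iJ.
    by move/fintype.subsetP/(_ _ iJ): JI; rewrite iI.
  have /fintype.subsetPn[i iJ iI] := JI.
  by rewrite (bigD1 i) //= (negbTE iI) iJ mul0r.
rewrite (bigID (mem J)) /= [X in _ * X]big1 ?mulr1; last first.
  by move=> i /negbTE ->; rewrite addrC subrK.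
by rewrite -prodr_const; apply: eq_bigr => i ->; rewrite addr0.
Qed.

Lemma sum_sign_interval_upper J I :
  \sum_(S : {set K} | (J \subset S) && (S \subset I)) (-1) ^+ #|S :\: J| =
  (J == I)%:R :> R.
Proof.
(* Taking the first summand at the points of [S] yields the term of [S]. The factor at [i] is 0
   exactly on the symmetric difference of [I] and [J], and 1 elsewhere. *)
transitivity (\prod_(i : K) ((if i \in I then (if i \in J then 1 else -1) else 0)
                   + (if i \in J then 0 else 1 : R))).
  rewrite bigA_distr big_mkcond /=; apply: eq_bigr => S _; case: ifPn.
    move=> /andP[JS SI]; rewrite (bigID (mem (S :\: J))) /= [X in _ * X]big1.
      rewrite mulr1 -prodr_const; apply: eq_bigr => i; rewrite inE => /andP[iJ iS].
      by rewrite iS (fintype.subsetP SI) // (negbTE iJ).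
    move=> i; rewrite inE negb_and negbK.
    case: ifPn => [iS | /negbTE iS]; first by rewrite orbF (fintype.subsetP SI) // => ->.
    by move=> _; rewrite ifN //; apply: contraFN iS => /(fintype.subsetP JS).
  rewrite negb_and => /orP[/fintype.subsetPn[i iJ iS]|/fintype.subsetPn[i iS iI]].
    by rewrite (bigD1 i) //= (negbTE iS) iJ mul0r.
  by rewrite (bigD1 i) //= iS (negbTE iI) mul0r.
have [<-|JI] := eqVneq J I.
  by rewrite big1 // => i _; case: (i \in J); rewrite ?addr0 ?add0r.
have /existsP[i iJI] : [exists i, (i \in J) != (i \in I)].
  apply: contraNT JI; rewrite negb_exists => /forallP h.
  by apply/eqP/setP => i; have := h i; rewrite negbK => /eqP.
rewrite (bigD1 i) //=; move: iJI.
by case: (i \in J); case: (i \in I) => //= _; rewrite ?addr0 ?addNr mul0r.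
Qed.

Lemma sum_sign_interval_lower J I :
  \sum_(S : {set K} | (J \subset S) && (S \subset I)) (-1) ^+ #|I :\: S| =
  (J == I)%:R :> R.
Proof.
rewrite -(inj_eq (@finset.setC_inj K)) eq_sym -sum_sign_interval_upper.
rewrite (reindex_inj (inv_inj (@finset.setCK K))) /=; apply: eq_big => S.
  by rewrite finset.subsetC finset.subCset andbC.
by move=> _; rewrite !finset.setDE !finset.setCK finset.setIC.
Qed.

(** Möbius inversion over subsets: the inner alternating sum is the candidate for the weight of
    [S]. *)
Lemma subset_mobius F I :
  F I = \sum_(S : {set K} | S \subset I)
          \sum_(J : {set K} | J \subset S) (-1) ^+ #|S :\: J| * F J.
Proof.
rewrite (exchange_big_dep predT) //=.
transitivity (\sum_(J : {set K}) (J == I)%:R * F J).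
  by rewrite (bigD1 I) //= eqxx mul1r big1 ?addr0 // => J /negbTE ->; rewrite mul0r.
apply: eq_bigr => J _; rewrite -sum_sign_interval_upper mulr_suml.
by apply: eq_bigl => S; rewrite andbC.
Qed.

(** A set lies in the intersection of [I] and [J] exactly when it lies in both, so the weights
    diagonalise the bilinear form. *)
Lemma sum_zeta_quadratic (F w c e : {set K} -> R) :
  (forall I, F I = \sum_(S : {set K} | S \subset I) w S) ->
  \sum_(I : {set K}) \sum_(J : {set K}) c I * e J * F (I :&: J) =
  \sum_(S : {set K}) w S * ((\sum_(I : {set K} | S \subset I) c I) *
                (\sum_(I : {set K} | S \subset I) e I)).
Proof.
move=> Fw.
transitivity (\sum_(I : {set K}) \sum_(J : {set K}) \sum_S
   w S * ((if S \subset I then c I else 0) * (if S \subset J then e J else 0))).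
  apply: eq_bigr => I _; apply: eq_bigr => J _; rewrite Fw mulr_sumr big_mkcond.
  apply: eq_bigr => S _; rewrite finset.subsetI.
  by case: (S \subset I); case: (S \subset J); rewrite /= ?(mulr0, mul0r) // mulrC.
under eq_bigr do rewrite exchange_big /=.
rewrite exchange_big /=; apply: eq_bigr => S _.
rewrite mulr_suml mulr_sumr [RHS]big_mkcond /=; apply: eq_bigr => I _.
case: (S \subset I); last by rewrite big1 // => J _; rewrite mul0r mulr0.
rewrite !mulr_sumr [RHS]big_mkcond /=; apply: eq_bigr => J _.
by case: (S \subset J); rewrite ?mulr0.
Qed.

End SubsetSums.

(** The Möbius weights are nonnegative because each of them is a value of the quadratic form. *)
Lemma gram_weights (R : realDomainType) (K : finType) (F : {set K} -> R) :
  (forall c : {set K} -> R,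
     0 <= \sum_(I : {set K}) \sum_(J : {set K}) c I * c J * F (I :&: J)) ->
  exists w : {set K} -> R, (forall S, 0 <= w S) /\
    forall I, F I = \sum_(S : {set K} | S \subset I) w S.
Proof.
move=> Fpos; pose w (S : {set K}) :=
  \sum_(J : {set K} | J \subset S) (-1) ^+ #|S :\: J| * F J.
have Fw I : F I = \sum_(S : {set K} | S \subset I) w S by exact: subset_mobius.
exists w; split => // S.
(* The sum of [c] over the supersets of [J] is 1 for [J = S] and 0 otherwise, so only the diagonal
   term [w S] survives. *)
pose c (I : {set K}) : R := if I \subset S then (-1) ^+ #|S :\: I| else 0.
have := Fpos c; rewrite (sum_zeta_quadratic _ _ Fw).
have cE (J : {set K}) : \sum_(I : {set K} | J \subset I) c I = (J == S)%:R.
  by rewrite -sum_sign_interval_lower big_mkcondr.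
rewrite (bigD1 S) //= cE eqxx !mulr1 big1 ?addr0 // => J /negbTE JS.
by rewrite cE JS !mulr0.
Qed.

(** * Finite algebras of sets *)

Section FiniteAlgebras.
Context {T : Type}.
Implicit Types (B : set (set T)) (A : set T).

(** A finite algebra is handled as the fibers of a map from points to atoms, so that its Boolean
    operations become those of [{set K}]. *)
Definition fiber (K : finType) (pi : T -> K) (I : {set K}) : set T :=
  [set x | pi x \in I].

Lemma set_algebraI B A A' : set_algebra B -> B A -> B A' -> B (A `&` A').
Proof.
move=> [_ BU BC] BA BA'; rewrite -(setCK (A `&` A')) setCI.
by apply: (BC); apply: BU; exact: BC.
Qed.

Lemma set_algebraD B A A' : set_algebra B -> B A -> B A' -> B (A `\` A').
Proof.
by move=> Balg BA BA'; rewrite setDE; apply: set_algebraI => //; case: Balg => _ _; apply.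
Qed.

Lemma set_algebraT B : set_algebra B -> B setT.
Proof. by move=> [B0 _ BC]; rewrite -setC0; exact: BC. Qed.

Lemma set_algebra_fin_bigcup B (K : finType) (P : pred K) (G : K -> set T) :
  set_algebra B -> (forall k, P k -> B (G k)) -> B (\big[setU/set0]_(k | P k) G k).
Proof. by move=> [B0 BU _] BG; elim/big_ind : _ => // *; exact: BU. Qed.

Lemma set_algebra_fin_bigcap B (K : finType) (G : K -> set T) :
  set_algebra B -> (forall k, B (G k)) -> B (\big[setI/setT]_k G k).
Proof.
move=> Balg BG; elim/big_ind : _ => //; first exact: set_algebraT.
by move=> *; exact: set_algebraI.
Qed.

(** A point is sent to the collection of members of [B] that contain it; the points sharing one such
    code form an atom. *)
Lemma finite_algebra_fibers B : set_algebra B -> finite_set B ->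
  exists (K : finType) (pi : T -> K),
    (forall k, exists x, pi x = k) /\ B = range (fiber pi).
Proof.
move=> Balg /finite_seqP[s Bs].
pose b (j : 'I_(size s)) := nth setT s j.
have Bb j : B (b j) by rewrite Bs /=; apply: mem_nth.
have Bex A : B A -> exists j, A = b j.
  rewrite Bs /= => sA; have lt : (index A s < size s)%N by rewrite index_mem.
  by exists (Ordinal lt); rewrite /b /= nth_index.
pose code (x : T) : {set 'I_(size s)} := [set j | `[< b j x >]]%SET.
(* Only the codes that occur are kept, which makes [pi] surjective. *)
pose K := {k : {set 'I_(size s)} | `[< exists x, code x = k >]}.
have codeP x : `[< exists y, code y = code x >] by apply/asboolP; exists x.
pose pi x : K := exist _ (code x) (codeP x).
exists K, pi; split=> [[k kP]|].
  by move/asboolP: (kP) => [x xk]; exists x; exact: val_inj.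
apply/seteqP; split=> A.
  move=> /Bex[j ->]; exists [set k : K | j \in val k]%SET => //.
  by apply/seteqP; split=> x; rewrite /fiber /= !inE.
move=> [I _ <-].
have -> : fiber pi I = \big[setU/set0]_(k in I) fiber pi [set k]%SET.
  rewrite -bigcup_seq_cond /=; apply/seteqP; split=> [x xI|x [k /= /andP[_ kI]]].
    by exists (pi x); rewrite /fiber /= ?mem_index_enum ?inE.
  by rewrite /fiber /= inE => /eqP ->.
apply: set_algebra_fin_bigcup => // k _.
(* The points with code [k] are those in every member listed in [k] and in the complement of every
   other member. *)
have -> : fiber pi [set k]%SET =
    \big[setI/setT]_j (if j \in val k then b j else ~` b j).
  rewrite -bigcap_seq /=; apply/seteqP; split=> x.
    rewrite /fiber /= inE => /eqP <- j _ /=; rewrite inE.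
    by case: asboolP.
  move=> xb; rewrite /fiber /= inE; apply/eqP; apply: val_inj; apply/setP => j /=.
  have := xb j (mem_index_enum _); rewrite inE.
  by case: ifPn => jk /= bjx; [apply/asboolP|apply/negbTE/asboolP].
apply: set_algebra_fin_bigcap => // j; case: ifP => // _.
by case: Balg => _ _; apply.
Qed.

Section Fibers.
Context {K : finType} (pi : T -> K) (pi_surj : forall k, exists x, pi x = k).
Implicit Types I J : {set K}.

Lemma fiberI I J : fiber pi (I :&: J) = fiber pi I `&` fiber pi J.
Proof.
by apply/seteqP; split=> x; rewrite /fiber /= inE; [move=> /andP[]|move=> [-> ->]].
Qed.

Lemma fiberU I J : fiber pi (I :|: J) = fiber pi I `|` fiber pi J.
Proof.
apply/seteqP; split=> x; rewrite /fiber /= inE; first by move=> /orP.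
by move=> xIJ; apply/orP.
Qed.

Lemma fiberC I : fiber pi (~: I) = ~` fiber pi I.
Proof. by apply/seteqP; split=> x; rewrite /fiber /= inE => /negP. Qed.

Lemma fiberT : fiber pi [set: K] = [set: T].
Proof. by apply/seteqP; split=> x; rewrite /fiber /= ?inE. Qed.

Lemma fiberS I J : fiber pi I `<=` fiber pi J -> I \subset J.
Proof.
by move=> IJ; apply/fintype.subsetP => k; have [x <-] := pi_surj k => xI; exact: (IJ x).
Qed.

Lemma fiber_inj : injective (fiber pi).
Proof.
move=> I J IJ; apply/eqP; rewrite finset.eqEsubset.
by apply/andP; split; apply: fiberS; rewrite IJ.
Qed.

Lemma atoms_fibers I :
  [set a | atoms (range (fiber pi)) a /\ a `<=` fiber pi I] =
  [set fiber pi [set k]%SET | k in [set` I]].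
Proof.
apply/seteqP; split=> [a [[[J _ <-] [x xJ] Jmin] JI]|a [k kI <-]].
  have fk : fiber pi [set pi x]%SET `<=` fiber pi J.
    by move=> y; rewrite /fiber /= inE => /eqP ->.
  exists (pi x); first exact: (JI x).
  have [|fk0|//] := Jmin (fiber pi [set pi x]%SET) _ fk; first by exists [set pi x]%SET.
  have : fiber pi [set pi x]%SET x by rewrite /fiber /= inE.
  by rewrite fk0.
split; last by move=> y; rewrite /fiber /= inE => /eqP ->.
have [x xk] := pi_surj k; split; first by exists [set k]%SET.
  by exists x; rewrite /fiber /= inE xk.
move=> _ [J _ <-] /fiberS; rewrite finset.subset1 => /orP[/eqP ->|/eqP ->]; [by right|left].
by apply/seteqP; split=> y //; rewrite /fiber /= inE.
Qed.

Lemma natoms_fiber I : natoms (range (fiber pi)) (fiber pi I) = #|I|.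
Proof.
rewrite /natoms atoms_fibers fset_set_image //.
rewrite card_in_imfset /=; last by move=> k l _ _ /fiber_inj/finset.set1_inj.
have -> : [set` I] = [set` [fset k in I]%fset].
  by apply/seteqP; split=> k; rewrite /= !inE.
by rewrite set_fsetK card_finset.
Qed.

End Fibers.
End FiniteAlgebras.

(** This is the expectation of [h] at a random union of atoms of [B], each atom being kept
    independently with probability [p]. *)
Definition avg {T : Type} {R : realType} (B : set (set T)) (p : R)
    (h : set T -> R) : R :=
  \sum_(A \in B) atom_mass B p A * h A.

(** * Averages over random unions of atoms *)

Section Averages.
Context {T : Type} {R : realType}.
Implicit Types (B : set (set T)) (p : R) (h : set T -> R).

Lemma avg_fibers (K : finType) (pi : T -> K) p h :
  (forall k, exists x, pi x = k) ->
  avg (range (fiber pi)) p h =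
  \sum_(I : {set K}) p ^+ #|I| * (1 - p) ^+ (#|K| - #|I|) * h (fiber pi I).
Proof.
move=> pi_surj; rewrite /avg fsbig_image; last by move=> I J _ _; exact: fiber_inj.
have KE : [set: {set K}] = [set` index_enum {set K}].
  by apply/seteqP; split=> I //= _; rewrite mem_index_enum.
rewrite [X in \sum_(_ \in X) _]KE -fsbig_seq ?index_enum_uniq //; apply: eq_bigr => I _.
by rewrite /atom_mass -(fiberT pi) !natoms_fiber // cardsT.
Qed.

Section FiniteAlgebra.
Context {B : set (set T)} (B_alg : set_algebra B) (B_fin : finite_set B).

Lemma avg_affine p c k h : avg B p (fun A => c + k * h A) = c + k * avg B p h.
Proof.
have [K [pi [pi_surj ->]]] := finite_algebra_fibers B_alg B_fin.
rewrite !avg_fibers //; under eq_bigr do rewrite mulrDr.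
rewrite big_split -mulr_suml /=; congr (_ + _).
  rewrite -[RHS]mul1r; congr (_ * _).
  (* The total mass 1 is the chance that the random subset contains the empty set. *)
  rewrite -[RHS](expr0 p) -(finset.cards0 K) -sum_bernoulli_superset.
  by apply: eq_bigl => I; rewrite finset.sub0set.
by rewrite mulr_sumr; apply: eq_bigr => I _; rewrite mulrCA.
Qed.

Lemma avg_cst p c : avg B p (fun=> c) = c.
Proof.
have := avg_affine p c 0 (fun=> 0).
by rewrite [_ * avg _ _ _]mul0r mulr0 !addr0.
Qed.

Lemma avg_ler p h h' : 0 <= p <= 1 -> (forall A, B A -> h A <= h' A) ->
  avg B p h <= avg B p h'.
Proof.
move=> /andP[p0 p1] hh'.
have [K [pi [pi_surj E]]] := finite_algebra_fibers B_alg B_fin.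
rewrite {}E in hh' *; rewrite !avg_fibers //; apply: ler_sum => I _.
apply: ler_wpM2l; last by apply: hh'; exists I.
by rewrite mulr_ge0 ?exprn_ge0 // subr_ge0.
Qed.

Lemma eq_avg p h h' : (forall A, B A -> h A = h' A) -> avg B p h = avg B p h'.
Proof. by move=> hh'; apply: eq_fsbigr => A /set_mem BA; rewrite hh'. Qed.

End FiniteAlgebra.

Lemma avg_exchange B B' p p' (h : set T -> set T -> R) :
  set_algebra B -> finite_set B -> set_algebra B' -> finite_set B' ->
  avg B p (fun A => avg B' p' (fun A' => h A A')) =
  avg B' p' (fun A' => avg B p (fun A => h A A')).
Proof.
move=> Ba Bf B'a B'f.
have [K [pi [pi_surj ->]]] := finite_algebra_fibers Ba Bf.
have [K' [pi' [pi'_surj ->]]] := finite_algebra_fibers B'a B'f.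
rewrite !avg_fibers //.
under eq_bigr do rewrite avg_fibers // mulr_sumr.
rewrite exchange_big /=; apply: eq_bigr => J _.
rewrite avg_fibers // mulr_sumr; apply: eq_bigr => I _.
by rewrite mulrCA.
Qed.

End Averages.

(** When [f A] is the squared norm of E_A X, the double sum is the squared norm of the combination
    of the projections of X with coefficients [c]. *)
Definition gram_positive {T : Type} {R : realType} (Alg : set (set T))
    (f : set T -> R) :=
  forall (K : finType) (pi : T -> K), (forall I, Alg (fiber pi I)) ->
  forall c : {set K} -> R,
    0 <= \sum_(I : {set K}) \sum_(J : {set K}) c I * c J * f (fiber pi (I :&: J)).

(** * Spectral weights on nested finite algebras *)

Section SpectralWeights.
Context {T : Type} {R : realType} {Alg : set (set T)}.
Variables (f : set T -> R).
Hypothesis f_pos : gram_positive Alg f.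

(** The weights live on sets of atoms of the finer algebra, and [phi] sends a fine atom to the
    coarse atom around it. Random unions of coarse atoms can thus be tested against sets of the
    finer level. *)
Lemma algebra_weights B B' : set_algebra B -> finite_set B ->
  finite_subalgebra B' Alg -> B `<=` B' ->
  exists (K K' : finType) (pi : T -> K') (phi : K' -> K) (w : {set K'} -> R),
    [/\ (forall k, exists x, pi x = k), (forall k, exists x, phi (pi x) = k),
        B = range (fiber (phi \o pi)) /\ B' = range (fiber pi),
        (forall S, 0 <= w S) &
        forall I, f (fiber pi I) = \sum_(S : {set K'} | S \subset I) w S].
Proof.
move=> Ba Bf [B'a B'f B'Alg] BB'.
have [K [rho [rho_surj Brho]]] := finite_algebra_fibers Ba Bf.
have [K' [pi [pi_surj Bpi]]] := finite_algebra_fibers B'a B'f.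
have [|w [w0 wf]] := @gram_weights R K' (fun I => f (fiber pi I)).
  by move=> c; apply: f_pos => I; apply: B'Alg; rewrite Bpi; exists I.
(* An atom of [B] is a member of [B'], so it cannot separate two points of one atom of [B']. *)
have rho_pi x y : pi x = pi y -> rho x = rho y.
  move=> xy; have [J _ piJ] : range (fiber pi) (fiber rho [set rho y]%SET).
    by rewrite -Bpi; apply: BB'; rewrite Brho; exists [set rho y]%SET.
  have : fiber rho [set rho y]%SET y by rewrite /fiber /= inE.
  rewrite -piJ /fiber /= -xy => xJ.
  have : fiber rho [set rho y]%SET x by rewrite -piJ.
  by rewrite /fiber /= inE => /eqP.
have [s sK] := choice pi_surj.
have phiE x : rho (s (pi x)) = rho x by apply: rho_pi.
exists K, K', pi, (rho \o s), w; split=> //.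
  by move=> k; have [x <-] := rho_surj k; exists x; exact: phiE.
suff -> : (rho \o s) \o pi = rho by [].
by apply/funext => x; exact: phiE.
Qed.

Section Weights.
Context {K K' : finType} (pi : T -> K') (phi : K' -> K) (w : {set K'} -> R).
Hypotheses (phipi_surj : forall k, exists x, phi (pi x) = k).
Hypothesis fw : forall I, f (fiber pi I) = \sum_(S : {set K'} | S \subset I) w S.

Lemma fiber_comp (I : {set K}) : fiber (phi \o pi) I = fiber pi (phi @^-1: I).
Proof. by apply/seteqP; split=> x; rewrite /fiber /= inE. Qed.

(** A set [S] inside [G] is covered exactly when every coarse atom met by [S :\: E] is kept, which
    has probability [p] to the number of these atoms. *)
Lemma avg_weights p (E G : {set K'}) :
  avg (range (fiber (phi \o pi))) p
    (fun A => f ((A `|` fiber pi E) `&` fiber pi G)) =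
  \sum_(S : {set K'} | S \subset G) w S * p ^+ #|phi @: (S :\: E)|.
Proof.
rewrite avg_fibers //.
under eq_bigr do rewrite fiber_comp -fiberU -fiberI fw mulr_sumr.
rewrite (exchange_big_dep (fun S : {set K'} => S \subset G)) /=; last first.
  by move=> I S _; rewrite finset.subsetI => /andP[].
apply: eq_bigr => S SG; rewrite -sum_bernoulli_superset mulr_sumr.
apply: eq_big => [I|I _]; last by rewrite mulrC.
by rewrite finset.subsetI SG andbT finset.setUC -finset.subDset sub_imset_pre.
Qed.

Lemma hit_weights (C : {set K'}) :
  f setT - f (~` fiber pi C) = \sum_(S : {set K'} | S :&: C != finset.set0) w S.
Proof.
rewrite -(fiberT pi) -fiberC !fw (bigID (fun S : {set K'} => S \subset ~: C)) /=.
rewrite addrAC [X in X - _](eq_bigl (fun S : {set K'} => S \subset ~: C)).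
  rewrite subrr add0r; apply: eq_bigl => S.
  by rewrite finset.subsetT -finset.disjoints_subset -finset.setI_eq0.
by move=> S; rewrite finset.subsetT.
Qed.

End Weights.
End SpectralWeights.

(** * Spectral weights and the averaging argument *)

Section Exhaustions.
Context {T : Type} {Alg : set (set T)} {AA : nat -> set (set T)}.
Hypothesis AA_exh : exhaustion AA Alg.

Lemma exhaustion_le m n : (m <= n)%N -> AA m `<=` AA n.
Proof.
move=> /subnK <-; elim: (n - m)%N => //= k IH; apply: (subset_trans IH).
by rewrite addSn; case: AA_exh => _ + _; apply.
Qed.

Lemma exhaustion_sub m : AA m `<=` Alg.
Proof. by case: AA_exh => /(_ m)[]. Qed.

Lemma exhaustion_level A : Alg A -> exists m, AA m A.
Proof. by case: AA_exh => _ _ <- [m _ mA]; exists m. Qed.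

Lemma exhaustion_algebra m : set_algebra (AA m).
Proof. by case: AA_exh => /(_ m)[]. Qed.

Lemma exhaustion_finite m : finite_set (AA m).
Proof. by case: AA_exh => /(_ m)[]. Qed.

Lemma exhaustion_finite_subalgebra m : finite_subalgebra (AA m) Alg.
Proof. by case: AA_exh. Qed.

End Exhaustions.

(* [f A] is the probability that a random closed subset M of the Stone space of
   the algebra is contained in A.  Then [hit f C] is the probability that M
   meets C, and [miss f B p D] averages this over the random union of atoms of
   B that omits each atom independently with probability p, intersected with D. *)
Definition hit {T : Type} {R : realType} (f : set T -> R) (C : set T) : R :=
  f setT - f (~` C).

Definition miss {T : Type} {R : realType} (f : set T -> R) B (p : R) D :=
  avg B p (fun A => hit f (D `\` A)).

(** For the random set M this forces the mass of the event that M meets [D] in infinitely many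
    points to be at least [e]: a finite intersection would be missed by sufficiently sparse random
    unions. *)
Definition nonnegligible {T : Type} {R : realType} (f : set T -> R)
    (AA : nat -> set (set T)) D (e : R) :=
  forall p, 0 <= p < 1 -> exists m, e < miss f (AA m) p D.

Section Spectrum.
Context {T : Type} {R : realType} {Alg : set (set T)} {AA : nat -> set (set T)}.
Hypothesis Alg_alg : set_algebra Alg.
Hypothesis AA_exh : exhaustion AA Alg.
Context {f : set T -> R}.
Hypothesis f_pos : gram_positive Alg f.

Let AAa := exhaustion_algebra AA_exh.
Let AAf := exhaustion_finite AA_exh.

Lemma gram_positive_ge0 A : Alg A -> 0 <= f A.
Proof.
move=> /(exhaustion_level AA_exh)[n nA].
have [K [K' [pi [phi [w [_ _ [_ E] w0 fw]]]]]] := algebra_weights f_pos (AAa n)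
  (AAf n) (exhaustion_finite_subalgebra AA_exh n) (@subset_refl _ _).
by move: nA; rewrite E => -[I _ <-]; rewrite fw sumr_ge0.
Qed.

Lemma gram_positive_le A A' : Alg A -> Alg A' -> A `<=` A' -> f A <= f A'.
Proof.
move=> /(exhaustion_level AA_exh)[n nA] /(exhaustion_level AA_exh)[m mA'] AA'.
have {}nA : AA (maxn n m) A by apply: (exhaustion_le AA_exh) nA; exact: leq_maxl.
have {}mA' : AA (maxn n m) A' by apply: (exhaustion_le AA_exh) mA'; exact: leq_maxr.
have [K [K' [pi [phi [w [pis _ [_ E] w0 fw]]]]]] := algebra_weights f_pos (AAa _)
  (AAf _) (exhaustion_finite_subalgebra AA_exh (maxn n m)) (@subset_refl _ _).
move: nA mA' AA'; rewrite E => -[I _ <-] [J _ <-] /(fiberS pis) IJ.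
rewrite !fw [leRHS](bigID (fun S : {set K'} => S \subset I)) /=.
rewrite [X in _ <= X + _](eq_bigl (fun S : {set K'} => S \subset I)).
  by rewrite lerDl sumr_ge0.
move=> S; case: (boolP (S \subset I)) => [SI|_]; last by rewrite andbF.
by rewrite (fintype.subset_trans SI IJ).
Qed.

Local Notation hit := (hit f).
Local Notation miss := (miss f).
Local Notation nonnegligible := (nonnegligible f AA).

Lemma hit_le_subset C C' : Alg C -> Alg C' -> C `<=` C' -> hit C <= hit C'.
Proof.
move=> AC AC' CC'; have [_ _ AlgC] := Alg_alg; rewrite /hit lerD2l lerN2.
by apply: gram_positive_le; [exact: AlgC|exact: AlgC|exact: subsetC].
Qed.

Lemma hit_le C : Alg C -> hit C <= f setT.
Proof.
move=> AC; have [_ _ AlgC] := Alg_alg; rewrite /hit gerBl.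
exact/gram_positive_ge0/AlgC.
Qed.

Lemma Alg_setD m A D : AA m A -> Alg D -> Alg (D `\` A).
Proof.
by move=> mA AD; apply: set_algebraD => //; exact: exhaustion_sub mA.
Qed.

Lemma miss_le m p D : 0 <= p <= 1 -> Alg D -> miss (AA m) p D <= f setT.
Proof.
move=> p01 AD; rewrite -(avg_cst (AAa m) (AAf m) p (f setT)).
by apply: avg_ler => // A mA; apply: hit_le; exact: Alg_setD mA AD.
Qed.

Lemma miss_mono m p D D' : 0 <= p <= 1 -> Alg D -> Alg D' -> D `<=` D' ->
  miss (AA m) p D <= miss (AA m) p D'.
Proof.
move=> p01 AD AD' DD'; apply: avg_ler => // A mA.
apply: hit_le_subset; [exact: (Alg_setD mA)|exact: (Alg_setD mA)|exact: setSD].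
Qed.

Lemma missE m p D :
  miss (AA m) p D = f setT - avg (AA m) p (fun A => f (A `|` ~` D)).
Proof.
rewrite -mulN1r -avg_affine //; apply: eq_avg => A mA.
by rewrite /hit setDE setCI setCK setUC mulN1r.
Qed.

Lemma common_level m n D : Alg D ->
  exists k, [/\ (m <= k)%N, (n <= k)%N & AA k D].
Proof.
move=> /(exhaustion_level AA_exh)[l lD]; exists (maxn (maxn m n) l); split.
- by rewrite (leq_trans (leq_maxl m n)) ?leq_maxl.
- by rewrite (leq_trans (leq_maxr m n)) ?leq_maxl.
- by apply: (exhaustion_le AA_exh) lD; rewrite leq_maxr.
Qed.

(** In spectral weights, the term subtracted from [f setT] is a nonnegative combination of powers of
    [p]. *)
Lemma miss_antitone m p p' D : 0 <= p -> p <= p' -> p' <= 1 -> Alg D ->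
  miss (AA m) p' D <= miss (AA m) p D.
Proof.
move=> p0 pp' p'1 AD; have [k [mk _ kD]] := common_level m m AD.
have [K [K' [pi [phi [w [_ phis [E E'] w0 fw]]]]]] := algebra_weights f_pos
  (AAa m) (AAf m) (exhaustion_finite_subalgebra AA_exh k) (exhaustion_le AA_exh mk).
rewrite !missE lerD2l lerN2 E.
have : AA k (~` D) by case: (AAa k) => _ _; apply.
rewrite E' => -[G _ <-].
have avgG q : avg (range (fiber (phi \o pi))) q (fun A => f (A `|` fiber pi G)) =
    \sum_(S : {set K'} | S \subset [set: K']%SET) w S * q ^+ #|phi @: (S :\: G)|.
  by rewrite -(avg_weights phis fw) fiberT; apply: eq_fsbigr => A _; rewrite setIT.
rewrite !avgG; apply: ler_sum => S _; apply: ler_wpM2l => //.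
by apply: lerXn2r => //; rewrite ?nnegrE // (le_trans p0).
Qed.

(** If [S] meets [E], fix one common fine atom: the random set still meets [S] inside [E] as soon as
    the coarse atom around it is kept, which has probability [p]. *)
Lemma avg_hit m n p E : 0 <= p <= 1 -> (m <= n)%N -> AA n E ->
  p * hit E <= avg (AA m) p (fun A => hit (E `&` A)).
Proof.
move=> /andP[p0 p1] mn nE.
have [K [K' [pi [phi [w [_ phis [Em En] w0 fw]]]]]] := algebra_weights f_pos
  (AAa m) (AAf m) (exhaustion_finite_subalgebra AA_exh n) (exhaustion_le AA_exh mn).
move: nE; rewrite En => -[G _ <-]; rewrite Em avg_fibers // /hit (hit_weights fw).
under [leRHS]eq_bigr do
  rewrite fiber_comp -fiberI (hit_weights fw) mulr_sumr.
rewrite mulr_sumr (exchange_big_dep predT) //= big_mkcond /=; apply: ler_sum => S _.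
have mass_ge0 (I : {set K}) : 0 <= p ^+ #|I| * (1 - p) ^+ (#|K| - #|I|) * w S.
  by rewrite !mulr_ge0 ?exprn_ge0 // subr_ge0.
case: ifPn => [/finset.set0Pn[k]|_]; last by rewrite sumr_ge0.
rewrite inE => /andP[kS kG].
have := sum_bernoulli_superset p [set phi k]%SET.
rewrite finset.cards1 expr1 => /esym pE; rewrite [X in X * _ <= _]pE mulr_suml.
rewrite big_mkcond [leRHS]big_mkcond /=; apply: ler_sum => I _.
rewrite finset.sub1set; case: ifPn => [kI|_]; last by case: ifP.
rewrite ifT //; apply/finset.set0Pn; exists k; by rewrite !inE kS kG.
Qed.

(** After exchanging the two averages, [avg_hit] applies to each set D minus [A']. This is the sense
    in which a sparse deletion costs little. *)
Lemma avg_miss m m' p p' D : 0 <= p <= 1 -> 0 <= p' <= 1 -> Alg D ->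
  p * miss (AA m') p' D <= avg (AA m) p (fun A => miss (AA m') p' (D `&` A)).
Proof.
move=> p01 p'01 AD; rewrite avg_exchange //.
have := avg_affine (AAa m') (AAf m') p' 0 p (fun A => hit (D `\` A)).
rewrite add0r => <-; apply: avg_ler => // A' m'A'; rewrite add0r.
have [k [mk m'k kD]] := common_level m m' AD.
have kDA' : AA k (D `\` A').
  by apply: set_algebraD => //; exact: (exhaustion_le AA_exh m'k).
rewrite (le_trans (avg_hit p01 mk kDA')) //.
by apply: avg_ler => // A mA; rewrite setIDAC setIDA.
Qed.

(** On a finer partition a set meets at least as many atoms, and powers of [p] decrease with the
    exponent. *)
Lemma avg_setI_le m n p E : 0 <= p <= 1 -> (m <= n)%N -> AA n E ->
  avg (AA n) p (fun A => f (A `&` E)) <= avg (AA m) p (fun A => f (A `&` E)).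
Proof.
move=> /andP[p0 p1] mn nE.
have [K [K' [pi [phi [w [pis phis [Em En] w0 fw]]]]]] := algebra_weights f_pos
  (AAa m) (AAf m) (exhaustion_finite_subalgebra AA_exh n) (exhaustion_le AA_exh mn).
move: nE; rewrite En => -[G _ <-]; rewrite Em.
have avgG (L : finType) (psi : K' -> L) : (forall k, exists x, psi (pi x) = k) ->
  avg (range (fiber (psi \o pi))) p (fun A => f (A `&` fiber pi G)) =
    \sum_(S : {set K'} | S \subset G) w S * p ^+ #|psi @: S|.
  move=> psis.
  transitivity (\sum_(S : {set K'} | S \subset G)
                  w S * p ^+ #|psi @: (S :\: finset.set0)|); last first.
    by apply: eq_bigr => S _; rewrite finset.setD0.
  rewrite -(avg_weights psis fw); apply: eq_fsbigr => A _.
  suff -> : fiber pi finset.set0 = set0 by rewrite setU0.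
  by apply/seteqP; split=> x //; rewrite /fiber /= inE.
rewrite (avgG _ _ phis) (avgG _ id pis).
apply: ler_sum => S _; apply: ler_wpM2l => //.
by apply: ler_wiXn2l => //; rewrite (leq_trans (leq_imset_card _ _)) // imset_id.
Qed.

Hypothesis f_le1 : f setT <= 1.

(** Finitely many thresholds below 1 have a maximum below 1. *)
Lemma finite_uniform_lt1 (K : finType) (Q : K -> R -> Prop) (P : pred K) :
  (forall k, P k -> exists p, 0 <= p < 1 /\ forall p', p <= p' < 1 -> Q k p') ->
  exists p, 0 <= p < 1 /\ forall k, P k -> Q k p.
Proof.
move=> PQ.
have /choice[p pP] k : exists p, 0 <= p < 1 /\
    (P k -> forall p', p <= p' < 1 -> Q k p').
  have [/PQ[p [p01 pQ]]|_] := boolP (P k); first by exists p.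
  by exists 0; split => //; rewrite lexx ltr01.
exists (\big[Num.max/0]_k p k); split.
  apply/andP; split; first exact: bigmax_ge_id.
  by apply/bigmax_ltP; split => // k _; case: (pP k) => /andP[].
move=> k Pk; case: (pP k) => _ /(_ Pk); apply.
rewrite le_bigmax //=; apply/bigmax_ltP; split => // l _.
by case: (pP l) => /andP[].
Qed.

(** A Markov argument. Let a random [A] keep each atom with probability 1 - q. If no [A] worked,
    every [A] whose removed part is hit with mass at least e/2 would lower some [miss] by more than
    [eta], whereas on average this [miss] drops by at most a fraction q. Then the removed part is
    hit too rarely on average. *)
Lemma nonnegligible_split D e eta : Alg D -> 0 < eta -> eta < e ->
  nonnegligible D e ->
  exists A, [/\ Alg A, e / 2 <= hit (D `\` A) & nonnegligible (D `&` A) (e - eta)].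
Proof.
move=> AD eta0 etae De.
have e0 : 0 < e by exact: lt_trans etae.
have e1 : e < 1.
  have [|m em] := De 0; first by rewrite lexx ltr01.
  by apply: (lt_le_trans em); rewrite (le_trans (miss_le _ _ _)) // lexx ler01.
(* With [M <= 1] this makes the average drop [q * M], divided by [eta], at most e/4, so the
   contradiction is e < e/2 + e/4. *)
pose q := e * eta / 4.
have q0 : 0 < q by rewrite divr_gt0 // mulr_gt0.
have q1 : q < 1 by rewrite /q; nra.
have p01 : 0 <= 1 - q < 1 by lra.
have [m em] := De _ p01.
have p01' : 0 <= 1 - q <= 1 by lra.
apply: contrapT => noA.
have [K [pi [pis E]]] := finite_algebra_fibers (AAa m) (AAf m).
pose bad (I : {set K}) := e / 2 <= hit (D `\` fiber pi I).
have Alg_m A : AA m A -> Alg A by exact: (exhaustion_sub AA_exh).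
have mI I : AA m (fiber pi I) by rewrite E; exists I.
(* A [bad] set meets the first requirement, so it must fail the last one. By monotonicity in [p] the
   failure persists closer to 1, and one [p'] serves the finitely many bad sets. *)
have [|p' [p'01 p'bad]] := @finite_uniform_lt1 _
    (fun I p => forall m', miss (AA m') p (D `&` fiber pi I) <= e - eta) bad.
  move=> I badI.
  have nI : ~ nonnegligible (D `&` fiber pi I) (e - eta).
    by move=> nI; apply: noA; exists (fiber pi I); split => //; exact: Alg_m.
  apply: contrapT => nex; apply: nI => p p01p; apply: contrapT => nm; apply: nex.
  exists p; split => // p' /andP[pp' p'1] m'.
  have AI : Alg (D `&` fiber pi I) by apply: set_algebraI => //; exact: Alg_m.
  have [//|lt] := leP (miss (AA m') p' (D `&` fiber pi I)) (e - eta).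
  exfalso; apply: nm; exists m'; apply: (lt_le_trans lt).
  by apply: miss_antitone => //; [case/andP: p01p|exact: ltW].
have [m' em'] := De _ p'01; set M := miss _ _ _ in em'.
have p'01' : 0 <= p' <= 1 by case/andP: p'01 => -> /ltW.
have M1 : M <= 1 by apply: le_trans f_le1; exact: miss_le.
(* The Markov bound: either the left side is below e/2, or [A] is bad and the drop from [M] exceeds
   [eta], so that the quotient is at least 1. *)
have hitle A : AA m A -> hit (D `\` A) <=
    (e / 2 + M / eta) + (- eta^-1) * miss (AA m') p' (D `&` A).
  move=> mA; have AA' := Alg_m _ mA.
  have AI : Alg (D `&` A) by exact: set_algebraI.
  have missM : miss (AA m') p' (D `&` A) <= M.
    by apply: miss_mono => //; exact: subIsetl.
  have hit1 : hit (D `\` A) <= 1.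
    by apply: le_trans f_le1; apply: hit_le; exact: set_algebraD.
  rewrite -addrA [M / eta + _](_ : _ = (M - miss (AA m') p' (D `&` A)) / eta); last first.
    by rewrite mulrBl mulNr [eta^-1 * _]mulrC.
  have [lt|ge] := ltP (hit (D `\` A)) (e / 2).
    rewrite (le_trans (ltW lt)) // lerDl divr_ge0 ?subr_ge0 //; exact: ltW.
  have [I _ IA] : range (fiber pi) A by rewrite -E.
  have := p'bad I; rewrite /bad IA => /(_ ge m') lem.
  apply: (le_trans hit1); apply: ler_wpDl; first by rewrite divr_ge0 ?ltW.
  by rewrite ler_pdivlMr // mul1r; lra.
have := avg_ler (AAa m) (AAf m) p01' hitle; rewrite avg_affine //.
rewrite -[X in X <= _]/(miss _ _ _) => missle.
have := avg_miss m m' p01' p'01' AD; rewrite -/M => missge.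
set a := avg _ _ _ in missle missge.
have : miss (AA m) (1 - q) D <= e / 2 + (M - a) / eta.
  by apply: (le_trans missle); rewrite mulrBl mulNr [eta^-1 * _]mulrC addrA.
apply/negP; rewrite -ltNge (le_lt_trans _ em) //.
have : (M - a) / eta <= e / 4.
  rewrite ler_pdivrMr // mulrAC -/q.
  have : 0 <= M by exact/ltW/(lt_trans e0).
  nra.
lra.
Qed.

Hypothesis f_cont : forall A : nat -> set T,
  (forall k, Alg (A k)) -> (forall k, A k `<=` A k.+1) ->
  forall e, 0 < e -> exists k, forall n, (k <= n)%N ->
    f setT - f (A k `|` ~` A n) <= e.

(** Were the whole space nonnegligible, repeated splitting would give decreasing sets whose
    successive differences are all hit with mass at least e/4. Their complements increase, which
    contradicts [f_cont]. *)
Lemma uniform_stability e : 0 < e ->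
  exists p, 0 <= p < 1 /\ forall m, miss (AA m) p setT <= e.
Proof.
move=> e0; apply: contrapT => nex.
have nonT : nonnegligible setT e.
  move=> p p01; apply: contrapT => nm; apply: nex; exists p; split => // m.
  by rewrite leNgt; apply/negP => lt; apply: nm; exists m.
(* The levels fall from e at [k = 0] but stay above e/2; their gaps serve as [eta]. *)
pose ek k := e / 2 + e / 2 / 2 ^+ k.
have ek_gt k : e / 2 < ek k.
  by rewrite /ek ltrDl divr_gt0 ?exprn_gt0 // divr_gt0.
have ek_gap k : ek k - ek k.+1 = e / 4 / 2 ^+ k.
  by rewrite /ek exprS; field; rewrite expf_neq0.
have /choice[next nextP] (D : set T * nat) : exists A,
    Alg D.1 -> nonnegligible D.1 (ek D.2) ->
    [/\ Alg A, e / 4 <= hit (D.1 `\` A) & nonnegligible (D.1 `&` A) (ek D.2.+1)].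
  case: D => D k /=; apply: contrapT => nA; apply: nA.
  have [AD|nAD] := pselect (Alg D); last by exists set0.
  have [nD|nnD] := pselect (nonnegligible D (ek k)); last by exists set0.
  have gap0 : 0 < ek k - ek k.+1 by rewrite ek_gap divr_gt0 ?exprn_gt0 ?divr_gt0.
  have [|A [AA1 Ah An]] := nonnegligible_split AD gap0 _ nD.
    by have := ek_gt k.+1; lra.
  exists A => _ _; split => //; first by have := ek_gt k; lra.
  by move: An; rewrite opprB addrC subrK.
pose Dk := fix Dk k := if k is k'.+1 then Dk k' `&` next (Dk k', k') else setT.
have Dprop k : Alg (Dk k) /\ nonnegligible (Dk k) (ek k).
  elim: k => [|k [AD nD]] /=.
    split; first exact: set_algebraT.
    by rewrite /ek expr0 divr1 -splitr.
  have [|//|AN _ ?] := nextP (Dk k, k); first by [].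
  by split => //; exact: set_algebraI.
have [_ _ AlgC] := Alg_alg.
have AC k : Alg (~` Dk k) by apply: AlgC; case: (Dprop k).
have CS k : ~` Dk k `<=` ~` Dk k.+1 by apply: subsetC; exact: subIsetl.
have e80 : 0 < e / 8 by rewrite divr_gt0.
have [k kP] := f_cont AC CS e80.
have := kP _ (leqnSn k); rewrite setCK /=.
have [AD nD] := Dprop k; have [//|//|_ + _] := nextP (Dk k, k).
rewrite /hit setDE setCI setCK /=.
(* Both sides are the complement of the part removed at stage [k], so the mass hitting this part is
   at most e/8 and at least e/4. *)
have -> : ~` Dk k `|` Dk k `&` next (Dk k, k) = ~` Dk k `|` next (Dk k, k).
  by rewrite setUIr setUC setUv setTI.
lra.
Qed.

End Spectrum.

(** * Bounded functions measurable with respect to a subfield *)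

Section FieldMeasurable.
Context {d : measure_display} {Om : measurableType d} {R : realType}.
Implicit Types (G H : set (set Om)) (X Y : Om -> R).

Lemma field_measurableP G X : sigma_algebra setT G ->
  field_measurable G X <->
  measurable_fun [set: g_sigma_algebraType G] (X : g_sigma_algebraType G -> R).
Proof.
move=> sG; split=> [XG _ B mB|mX A [B mB <-]].
  rewrite /measurable /= sigma_algebra_id //; apply: XG.
  by exists B.
by have := mX measurableT B mB; rewrite {1}/measurable /= sigma_algebra_id.
Qed.

Lemma field_measurable_sub G H X : G `<=` H -> field_measurable G X ->
  field_measurable H X.
Proof. by move=> GH XG; exact: subset_trans GH. Qed.

Lemma field_measurable_measurable G X : G `<=` measurable ->
  field_measurable G X -> measurable_fun [set: Om] X.
Proof. by move=> Gm XG _ B mB; apply/Gm/XG; exists B. Qed.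

Lemma field_measurable_comp (u : R -> R) G X : measurable_fun setT u ->
  field_measurable G X -> field_measurable G (fun w => u (X w)).
Proof.
move=> mu XG A [B mB <-]; apply: XG; exists (u @^-1` B) => //.
by rewrite -[_ @^-1` _]setTI; exact: mu.
Qed.

(** A bound at every point, not only almost everywhere, makes the class closed under products and
    every member integrable. *)
Definition bounded_measurable G X :=
  field_measurable G X /\ exists M, forall w, `|X w| <= M.

Section SigmaAlgebra.
Context {G : set (set Om)} (sG : sigma_algebra setT G).

Lemma bounded_measurable_cst r : bounded_measurable G (fun=> r).
Proof.
split; last by exists `|r|.
by apply/(field_measurableP _ sG); exact: measurable_cst.
Qed.

Lemma bounded_measurableD X Y : bounded_measurable G X ->
  bounded_measurable G Y -> bounded_measurable G (fun w => X w + Y w).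
Proof.
move=> [XG [M XM]] [YG [N YN]]; split.
  apply/(field_measurableP _ sG); apply: measurable_funD.
    exact/(field_measurableP _ sG).
  exact/(field_measurableP _ sG).
by exists (M + N) => w; rewrite (le_trans (ler_normD _ _)) // lerD.
Qed.

Lemma bounded_measurableM X Y : bounded_measurable G X ->
  bounded_measurable G Y -> bounded_measurable G (fun w => X w * Y w).
Proof.
move=> [XG [M XM]] [YG [N YN]]; split.
  apply/(field_measurableP _ sG); apply: measurable_funM.
    exact/(field_measurableP _ sG).
  exact/(field_measurableP _ sG).
by exists (M * N) => w; rewrite normrM ler_pM.
Qed.

Lemma bounded_measurableZ r X : bounded_measurable G X ->
  bounded_measurable G (fun w => r * X w).
Proof. by apply: bounded_measurableM; exact: bounded_measurable_cst. Qed.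

Lemma bounded_measurableB X Y : bounded_measurable G X ->
  bounded_measurable G Y -> bounded_measurable G (fun w => X w - Y w).
Proof.
move=> bX bY; have := bounded_measurableD bX (bounded_measurableZ (-1) bY).
by under eq_fun do rewrite mulN1r.
Qed.

Lemma bounded_measurable_sum (I : Type) (s : seq I) (Q : pred I) (X : I -> Om -> R) :
  (forall i, bounded_measurable G (X i)) ->
  bounded_measurable G (fun w => \sum_(i <- s | Q i) X i w).
Proof.
move=> bX; elim: s => [|i s IH].
  under eq_fun do rewrite big_nil; exact: bounded_measurable_cst.
under eq_fun do rewrite big_cons; case: (Q i) => //.
exact: bounded_measurableD.
Qed.

Lemma bounded_measurable_indic A : G A -> bounded_measurable G (\1_A).
Proof.
move=> GA; split; last first.
  by exists 1 => w; rewrite indicE ger0_norm ?lern1 ?leq_b1 ?ler0n.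
apply/(field_measurableP _ sG); apply: measurable_indic.
by rewrite /measurable /= sigma_algebra_id.
Qed.

End SigmaAlgebra.

Lemma bounded_measurable_sub G H X : G `<=` H -> bounded_measurable G X ->
  bounded_measurable H X.
Proof. by move=> GH [XG ?]; split => //; exact: field_measurable_sub XG. Qed.

Lemma bounded_measurable_norm G X : bounded_measurable G X ->
  bounded_measurable G (fun w => `|X w|).
Proof.
move=> [XG [M XM]]; split; last by exists M => w; rewrite normr_id.
by apply: (@field_measurable_comp Num.norm).
Qed.

End FieldMeasurable.

(** * Expectations of bounded functions *)

Section Expectation.
Context {d : measure_display} {Om : measurableType d} {R : realType}.
Variable P : probability Om R.
Implicit Types (G H : set (set Om)) (X Y Z : Om -> R).

Definition esp X : R := \int[P]_w X w.

Let msets := sigma_algebra_measurable Om.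

Local Notation bm := (bounded_measurable (@measurable _ Om)).

Lemma bm_integrable X : bm X -> P.-integrable setT (EFin \o X).
Proof.
move=> [mX [M XM]]; apply: measurable_bounded_integrable => //.
- by rewrite ltey_eq fin_num_measure.
- exact: field_measurable_measurable mX.
- by exists M; split; [exact: num_real|move=> x Mx w _; exact: le_trans (XM w) (ltW Mx)].
Qed.

Lemma esp_EFin X : bm X -> (\int[P]_w (X w)%:E = (esp X)%:E)%E.
Proof.
move=> bX; rewrite /esp /Rintegral fineK //.
exact: integrable_fin_num (bm_integrable bX).
Qed.

Lemma espD X Y : bm X -> bm Y -> esp (fun w => X w + Y w) = esp X + esp Y.
Proof. by move=> bX bY; rewrite /esp RintegralD //; exact: bm_integrable. Qed.

Lemma espB X Y : bm X -> bm Y -> esp (fun w => X w - Y w) = esp X - esp Y.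
Proof. by move=> bX bY; rewrite /esp RintegralB //; exact: bm_integrable. Qed.

Lemma espZ r X : bm X -> esp (fun w => r * X w) = r * esp X.
Proof. by move=> bX; rewrite /esp RintegralZl //; exact: bm_integrable. Qed.

Lemma esp_cst r : esp (fun=> r) = r.
Proof.
rewrite /esp Rintegral_cst // -[RHS]mulr1; congr (_ * _).
exact: (congr1 fine (probability_setT P)).
Qed.

Lemma esp_ge0 X : (forall w, 0 <= X w) -> 0 <= esp X.
Proof. by move=> X0; exact: Rintegral_ge0. Qed.

Lemma esp_le X Y : bm X -> bm Y -> (forall w, X w <= Y w) -> esp X <= esp Y.
Proof.
by move=> bX bY XY; apply: le_Rintegral => //; exact: bm_integrable.
Qed.

Lemma eq_esp X Y : X =1 Y -> esp X = esp Y.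
Proof. by move=> /funext ->. Qed.

Lemma esp_sum (I : Type) (s : seq I) (X : I -> Om -> R) : (forall i, bm (X i)) ->
  esp (fun w => \sum_(i <- s) X i w) = \sum_(i <- s) esp (X i).
Proof.
move=> bX; elim: s => [|i s IH].
  by under eq_esp do rewrite big_nil; rewrite big_nil esp_cst.
under eq_esp do rewrite big_cons.
by rewrite big_cons espD ?IH //; exact: bounded_measurable_sum.
Qed.

Lemma esp_indic A : measurable A -> esp \1_A = fine (P A).
Proof.
by move=> mA; rewrite /esp /Rintegral integral_indic // setIT.
Qed.

Lemma esp_norm_le X e : bm X -> (forall w, `|X w| <= e) -> `|esp X| <= e.
Proof.
move=> bX Xe; have bc r : bm (fun=> r) by exact: bounded_measurable_cst.
rewrite ler_norml; apply/andP; split.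
  rewrite -(esp_cst (- e)); apply: esp_le => // w.
  by have := Xe w; rewrite ler_norml => /andP[].
rewrite -(esp_cst e); apply: esp_le => // w.
by have := Xe w; rewrite ler_norml => /andP[].
Qed.

End Expectation.

(** * Conditional probabilities *)

(** The Radon-Nikodym density is truncated at 1. On the set where it exceeds 1 the integral of its
    excess is [nu N - mu N], which is at most 0, so the truncation changes it on a null set only. *)
Lemma bounded_density {d : measure_display} {T : measurableType d} {R : realType}
    (mu nu : {finite_measure set T -> \bar R}) :
  (forall E, measurable E -> (nu E <= mu E)%E) ->
  exists Y : T -> R, [/\ measurable_fun setT Y, forall x, 0 <= Y x <= 1 &
    forall E, measurable E -> nu E = (\int[mu]_(x in E) (Y x)%:E)%E].
Proof.
move=> numu.
have dom : nu `<< mu.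
  apply/null_content_dominatesP => E mE E0; apply/eqP.
  by rewrite eq_le measure_ge0 andbT -E0 numu.
have [f [f0 ffin fint fE]] := radon_nikodym_sigma_finite dom.
pose g x := fine (f x).
have gE x : (g x)%:E = f x by rewrite fineK.
have mf : measurable_fun setT f := measurable_int _ fint.
have mg : measurable_fun setT g by apply: measurableT_comp => //; exact: measurable_fine.
pose Y x := Num.min (g x) 1.
have mY : measurable_fun setT Y by apply: measurable_minr => //; exact: measurable_cst.
pose N := [set x | 1 < g x].
have mN : measurable N.
  have := mg measurableT _ (measurable_itv `]1, +oo[).
  rewrite setTI; congr (measurable _).
  by apply/seteqP; split=> x; rewrite /N /= in_itv /= andbT.
have N0 : ae_eq mu N (fun x => (f x - 1)%E) (cst 0%E).
  apply/ae_eq_integral_abs => //.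
    by apply: emeasurable_funB; [exact: measurable_funTS|exact: measurable_cst].
  apply/eqP; rewrite eq_le integral_ge0 // andbT.
  rewrite (eq_integral (fun x => f x - 1)%E); last first.
    by move=> x; rewrite inE => Nx; rewrite gee0_abs // -gE -EFinB lee_fin subr_ge0 ltW.
  rewrite integralB //; last 2 first.
  - exact: integrableS fint.
  - exact: finite_measure_integrable_cst.
  rewrite -fE // integral_cst // mul1e sube_le0; exact: numu.
exists Y; split=> // [x|E mE].
  by rewrite /Y le_min ler01 andbT fine_ge0 //= ge_min lexx orbT.
rewrite fE //; apply: ae_eq_integral => //.
- exact: measurable_funTS.
- by apply/measurable_EFinP; exact: measurable_funTS.
apply: filterS N0 => x Nx Ex; rewrite /Y -gE; congr (_%:E).
have [//|gt] := leP (g x) 1.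
by move: (Nx gt); rewrite -gE -EFinB => -[] /eqP; rewrite subr_eq0 => /eqP.
Qed.

(** The two proofs about [G] appear in the term so that the measure structures declared below can be
    inferred from it. *)
Definition subfield_measure {d : measure_display} {Om : measurableType d}
    {R : realType} (mu : set Om -> \bar R) (G : set (set Om))
    of sigma_algebra setT G & G `<=` measurable :
    set (g_sigma_algebraType G) -> \bar R := mu.

Section SubfieldMeasure.
Context {d : measure_display} {Om : measurableType d} {R : realType}.
Variables (mu : {finite_measure set Om -> \bar R}) (G : set (set Om)).
Hypotheses (sG : sigma_algebra setT G) (Gm : G `<=` measurable).

Local Notation nu := (subfield_measure mu sG Gm).

Let Gmeas (E : set (g_sigma_algebraType G)) :
  measurable E -> measurable (E : set Om).
Proof. by rewrite measurable_g_measurableTypeE // => /Gm. Qed.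

Let nu0 : nu set0 = 0%E. Proof. exact: (@measure0 _ _ _ mu). Qed.

Let nu_ge0 E : (0 <= nu E)%E. Proof. exact: (@measure_ge0 _ _ _ mu). Qed.

Let nu_sigma_additive : semi_sigma_additive nu.
Proof.
move=> E mE tE mUE; apply: (@measure_semi_sigma_additive _ _ _ mu) => //.
  by move=> i; exact: Gmeas.
exact: Gmeas.
Qed.

HB.instance Definition _ := isMeasure.Build _ _ _ nu nu0 nu_ge0 nu_sigma_additive.

Let nu_fin : fin_num_fun nu.
Proof. by move=> E mE; apply: (fin_num_measure mu); exact: Gmeas. Qed.

HB.instance Definition _ := Measure_isFinite.Build _ _ _ nu nu_fin.

(** The restricted measure is the image of [mu] under the identity map, so this is a change of
    variables. *)
Lemma integral_subfield_measure (Y : Om -> R) : field_measurable G Y ->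
  (forall w, 0 <= Y w) -> forall E, G E ->
  (\int[nu]_(w in E) (Y w)%:E = \int[mu]_(w in E) (Y w)%:E)%E.
Proof.
move=> YG Y0 E GE.
have mid : measurable_fun setT (id : Om -> g_sigma_algebraType G).
  by move=> _ B mB; rewrite setTI preimage_id; exact: Gmeas.
have mE : measurable (E : set (g_sigma_algebraType G)).
  by rewrite measurable_g_measurableTypeE.
have mY : @measurable_fun _ _ (g_sigma_algebraType G) _ E (EFin \o Y).
  by apply/measurable_EFinP; apply: measurable_funTS; exact/(field_measurableP _ sG).
have := ge0_integral_pushforward mid mu mE mY.
rewrite preimage_id => <-; last by move=> w _; rewrite lee_fin.
by apply: eq_measure_integral => A mA _.
Qed.

End SubfieldMeasure.

(** * Bounded versions of conditional probabilities *)

Section Versions.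
Context {d : measure_display} {Om : measurableType d} {R : realType}.
Variable P : probability Om R.
Implicit Types (G H : set (set Om)) (a e : set Om) (X Y Z : Om -> R).

Local Notation bm := (bounded_measurable (@measurable _ Om)).

(* A version of the conditional probability of [a] given [G] that is bounded
   everywhere, not just almost everywhere. *)
Definition version G a Y := [/\ field_measurable G Y, forall w, 0 <= Y w <= 1 &
  forall e, G e -> esp P (fun w => \1_e w * Y w) = esp P (fun w => \1_e w * \1_a w)].

Let ms := sigma_algebra_measurable Om.
Let bmc := @bounded_measurable_cst _ Om R _ ms.
Let bmB := @bounded_measurableB _ Om R _ ms.
Let bmM := @bounded_measurableM _ Om R _ ms.
Let bmZ := @bounded_measurableZ _ Om R _ ms.
Let bmI := @bounded_measurable_indic _ Om R _ ms.

Lemma esp_indicM e Y : measurable e ->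
  (\int[P]_(w in e) (Y w)%:E)%E = (\int[P]_w (\1_e w * Y w)%:E)%E.
Proof.
move=> me; rewrite integral_mkcond; apply: eq_integral => w _.
by rewrite restrict_EFin /= patchE indicE; case: ifP => _; rewrite ?mul1r ?mul0r.
Qed.

Lemma integral_esp e Y : measurable e -> bm Y ->
  (\int[P]_(w in e) (Y w)%:E = (esp P (fun w => \1_e w * Y w))%:E)%E.
Proof.
by move=> me bY; rewrite esp_indicM // esp_EFin //; apply: bmM => //; exact: bmI.
Qed.

(** On [G], the measure of the part inside [a] is dominated by [P]; its density is the required
    version. *)
Lemma version_exists G a : sub_sigma_field P G -> measurable a ->
  exists Y, version G a Y.
Proof.
move=> [sG Gm _] ma.
pose mu : {finite_measure set (g_sigma_algebraType G) -> \bar R} :=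
  subfield_measure P sG Gm.
pose Pa : {finite_measure set Om -> \bar R} := mrestr P ma.
pose nu : {finite_measure set (g_sigma_algebraType G) -> \bar R} :=
  subfield_measure Pa sG Gm.
have [|Y [mY Y01 YE]] := @bounded_density _ _ _ mu nu.
  move=> E; rewrite measurable_g_measurableTypeE // => /Gm mE.
  by apply: le_measure; rewrite ?inE //; exact: measurableI.
have YG : field_measurable G Y by exact/(field_measurableP _ sG).
exists Y; split => // e Ge; have me := Gm _ Ge.
rewrite /esp /Rintegral -esp_indicM // -(integral_subfield_measure P sG Gm) //; last first.
  by move=> w; case/andP: (Y01 w).
have mea : measurable (e `&` a) by exact: measurableI.
have /YE <- : measurable (e : set (g_sigma_algebraType G)).
  by rewrite measurable_g_measurableTypeE.
transitivity (fine (P (e `&` a))); first by [].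
have := integral_indic P measurableT mea; rewrite setIT => <-.
by congr fine; apply: eq_integral => w _; rewrite indicI.
Qed.

Lemma bm_version G a Y : sub_sigma_field P G -> version G a Y ->
  bounded_measurable G Y.
Proof.
move=> _ [YG Y01 _]; split => //; exists 1 => w.
by have /andP[Y0 Y1] := Y01 w; rewrite ger0_norm.
Qed.

(** The sum counts the integers from 1 to [n] below or equal to [t], so it approximates [t] within 1
    on [0, n]. *)
Lemma staircase (n : nat) (t : R) : 0 <= t ->
  [/\ \sum_(j < n) (j.+1%:R <= t)%R%:R <= t,
      (n%:R <= t -> \sum_(j < n) (j.+1%:R <= t)%R%:R = n%:R :> R) &
      t <= n%:R -> t <= \sum_(j < n) (j.+1%:R <= t)%R%:R + 1].
Proof.
move=> t0; elim: n => [|n [IH1 IH2 IH3]].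
  rewrite big_ord0; split => // t1; rewrite add0r; exact: le_trans t1 ler01.
rewrite big_ord_recr /=; have [nt|tn] := leP n.+1%:R t.
  have nt' : n%:R <= t by rewrite (le_trans _ nt) // ler_nat.
  by rewrite IH2 // natr1; split=> // tn; rewrite (le_trans tn) // lerDl.
rewrite addr0; split=> // _.
have [/IH3//|nt] := leP t n%:R.
by rewrite (IH2 (ltW nt)) natr1; exact: ltW.
Qed.

(** Passes from indicators of events of [H] to [Z] by approximating [Z] uniformly within 1/n by a
    combination of indicators of its level sets. *)
Lemma eq_esp_mul H Z W W' : sub_sigma_field P H -> field_measurable H Z ->
  (forall w, 0 <= Z w <= 1) -> bm W -> bm W' ->
  (forall e, H e -> esp P (fun w => \1_e w * W w) = esp P (fun w => \1_e w * W' w)) ->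
  esp P (fun w => Z w * W w) = esp P (fun w => Z w * W' w).
Proof.
move=> [sH Hm _] ZH Z01 bW bW' eqW.
have bZ : bm Z.
  apply: (bounded_measurable_sub Hm); split => //; exists 1 => w.
  by have /andP[Z0 Z1] := Z01 w; rewrite ger0_norm.
pose D w := W w - W' w.
have bD : bm D by exact: bmB.
have [M DM] := bD.2.
have D0 e : H e -> esp P (fun w => \1_e w * D w) = 0.
  move=> He; have be := bmI (Hm _ He).
  rewrite /D; under eq_esp do rewrite mulrBr.
  by rewrite espB ?eqW ?subrr //; exact: bmM.
suff ZD0 : esp P (fun w => Z w * D w) = 0.
  apply/eqP; rewrite -subr_eq0 -espB; [|exact: bmM..].
  by apply/eqP; rewrite -[RHS]ZD0; apply: eq_esp => w; rewrite -mulrBr.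
have [w0 _] : [set: Om] !=set0 by exists point.
have M0 : 0 <= M by rewrite (le_trans _ (DM w0)).
apply/eqP; rewrite -normr_le0; apply/ler_addgt0Pr => eps eps0; rewrite add0r.
(* The error is at most [M] divided by [n], hence at most [eps]. *)
pose n := (Num.truncn (M / eps)).+1; have n0 : 0 < n%:R :> R by rewrite ltr0n.
pose b (j : 'I_n) := [set w | j.+1%:R <= n%:R * Z w].
have Hb j : H (b j).
  apply: (field_measurable_comp (u := fun x => n%:R * x) _ ZH).
    by apply: measurable_funM => //; exact: measurable_cst.
  exists `[j.+1%:R, +oo[%classic => //.
  by rewrite setTI; apply/seteqP; split=> w; rewrite /b /= in_itv /= andbT.
pose S w : R := n%:R^-1 * \sum_(j < n) \1_(b j) w.
have bS : bm S by apply: bmZ; apply: bounded_measurable_sum => // j; exact/bmI/Hm.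
have SD0 : esp P (fun w => S w * D w) = 0.
  rewrite /S; under eq_esp do rewrite -mulrA mulr_suml.
  rewrite espZ; last by apply: bounded_measurable_sum => // j; apply: bmM => //; exact/bmI/Hm.
  rewrite esp_sum; last by move=> j; apply: bmM => //; exact/bmI/Hm.
  by rewrite big1 ?mulr0 // => j _; exact: D0.
have -> : esp P (fun w => Z w * D w) = esp P (fun w => (Z w - S w) * D w).
  by under [RHS]eq_esp do rewrite mulrBl; rewrite espB ?SD0 ?subr0 //; exact: bmM.
apply: esp_norm_le => [|w]; first by apply: bmM => //; exact: bmB.
have /andP[Z0 Z1] := Z01 w.
have [|S1 _ S2] := @staircase n (n%:R * Z w); first by rewrite mulr_ge0 // ltW.
have SE : n%:R * S w = \sum_(j < n) (j.+1%:R <= n%:R * Z w)%R%:R.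
  rewrite /S mulrA divff ?mul1r ?gt_eqF //; apply: eq_bigr => j _.
  by rewrite indicE mem_setE.
have : `|n%:R * (Z w - S w)| <= 1.
  have nZ1 : n%:R * Z w <= n%:R by rewrite ler_piMr // ltW.
  by rewrite mulrBr SE ler_norml; move: S1 (S2 nZ1); lra.
rewrite normrM (ger0_norm (ltW n0)) => ZS.
rewrite normrM -(ler_pM2l n0) mulrA.
apply: (@le_trans _ _ (1 * M)).
  by apply: ler_pM => //; rewrite mulr_ge0 // ltW.
rewrite mul1r -ler_pdivrMr // ltW // /n; exact: truncnS_gt.
Qed.

Lemma version_integral G a Y e : sub_sigma_field P G -> measurable a ->
  version G a Y -> G e ->
  (\int[P]_(w in e) (Y w)%:E = \int[P]_(w in e) (\1_a w)%:E)%E.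
Proof.
move=> sG ma vY Ge; have [_ Gm _] := sG; have me := Gm _ Ge.
have bY := bounded_measurable_sub Gm (bm_version sG vY).
rewrite !integral_esp //; last exact: bmI.
by case: vY => _ _ ->.
Qed.

Lemma is_cond_exp_version G a Y : sub_sigma_field P G -> measurable a ->
  version G a Y -> is_cond_exp P G \1_a Y.
Proof.
move=> sG ma vY; have [_ Gm _] := sG.
split; [by case: vY| |by move=> e Ge; exact: version_integral vY Ge].
exact/bm_integrable/(bounded_measurable_sub Gm)/(bm_version sG vY).
Qed.

(** The event where [Y2 < Y1] belongs to [G], and the difference, positive there, integrates to 0
    over it. *)
Lemma is_cond_exp_le G X Y1 Y2 : sub_sigma_field P G ->
  is_cond_exp P G X Y1 -> is_cond_exp P G X Y2 -> {ae P, forall w, Y1 w <= Y2 w}.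
Proof.
move=> [sG Gm _] [Y1G iY1 Y1E] [Y2G iY2 Y2E].
pose E := [set w | Y2 w < Y1 w].
have GE : G E.
  have /(field_measurableP _ sG) mY1 := Y1G.
  have /(field_measurableP _ sG) mY2 := Y2G.
  have mB := measurable_funB mY1 mY2.
  have := mB measurableT _ (measurable_itv `]0, +oo[).
  rewrite setTI measurable_g_measurableTypeE //; congr G.
  by apply/seteqP; split=> w; rewrite /E /= in_itv /= andbT subr_gt0.
have mE := Gm _ GE.
have mY1 := field_measurable_measurable Gm Y1G.
have mY2 := field_measurable_measurable Gm Y2G.
have : ae_eq P E (fun w => (Y1 w)%:E - (Y2 w)%:E)%E (cst 0%E).
  apply/ae_eq_integral_abs => //.
    apply: emeasurable_funB; apply: measurable_funTS; exact/measurable_EFinP.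
  rewrite (eq_integral (fun w => (Y1 w)%:E - (Y2 w)%:E)%E); last first.
    move=> w; rewrite inE => Ew; rewrite gee0_abs // -EFinB lee_fin subr_ge0 ltW //.
  rewrite integralB //; [|exact: integrableS iY1|exact: integrableS iY2].
  rewrite Y1E // -Y2E // subee //.
  by apply: integrable_fin_num => //; exact: integrableS iY2.
apply: filterS => w Ew; have [//|lt] := leP (Y1 w) (Y2 w).
have := Ew lt; rewrite -EFinB => -[] /eqP; rewrite subr_eq0 => /eqP eqY.
by move: lt; rewrite eqY ltxx.
Qed.

Lemma cond_exp_version G a Y : sub_sigma_field P G -> measurable a ->
  version G a Y ->
  field_measurable G (cond_exp P G \1_a) /\
  {ae P, forall w, cond_exp P G \1_a w = Y w}.
Proof.
move=> sG ma vY; have cY := is_cond_exp_version sG ma vY.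
have cE : is_cond_exp P G \1_a (cond_exp P G \1_a).
  by apply: (@xgetPex _ _ [set Z | is_cond_exp P G \1_a Z]); exists Y.
split; first by case: cE.
apply: filterS2 (is_cond_exp_le sG cE cY) (is_cond_exp_le sG cY cE) => w le1 le2.
by apply/eqP; rewrite eq_le le1.
Qed.

Lemma sigma_algebra_set_algebra G : sigma_algebra setT G -> set_algebra G.
Proof.
move=> [G0 GC GU]; split => // [A B GA GB|A GA]; last by rewrite -setTD; exact: GC.
by rewrite -bigcup2E; apply: GU => -[|[|n]].
Qed.

Lemma sub_generated (S : set (set Om)) : S `<=` generated P S.
Proof. by move=> A SA; apply: sub_sigma_algebra; left. Qed.

Lemma generated_sub (S G : set (set Om)) : sub_sigma_field P G -> S `<=` G ->
  generated P S `<=` G.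
Proof.
move=> [sG _ nG] SG; apply: smallest_sub => // A [|]; [exact: SG|exact: nG].
Qed.

(** Conditioning [Y2] on the field generated by [G0] and [K] gives [Y0]. On an intersection of
    events from [G0] and [K] both sides factor by independence, and a Dynkin class argument covers
    the rest. *)
Lemma esp_version_generated (G0 K G2 : set (set Om)) a Y0 Y2 :
  sub_sigma_field P G0 -> sub_sigma_field P K -> sub_sigma_field P G2 ->
  measurable a -> G0 `<=` G2 -> independent P G2 K ->
  version G0 a Y0 -> version G2 a Y2 ->
  forall e, generated P (G0 `|` K) e ->
    esp P (fun w => \1_e w * Y2 w) = esp P (fun w => \1_e w * Y0 w).
Proof.
move=> s0 sK s2 ma G02 ind v0 v2.
have [a0 m0 n0] := s0; have [aK mK nK] := sK; have [a2 m2 n2] := s2.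
have b0 := bounded_measurable_sub m0 (bm_version s0 v0).
have b2 := bounded_measurable_sub m2 (bm_version s2 v2).
(* Integrals over [e] suit countable disjoint unions, expectations suit algebra; [espQ] passes
   between them. *)
pose Q := [set e | measurable e /\
  (\int[P]_(w in e) (Y2 w)%:E = \int[P]_(w in e) (Y0 w)%:E)%E].
have espQ e : measurable e ->
  (\int[P]_(w in e) (Y2 w)%:E = \int[P]_(w in e) (Y0 w)%:E)%E <->
  esp P (fun w => \1_e w * Y2 w) = esp P (fun w => \1_e w * Y0 w).
  by move=> me; rewrite !integral_esp //; split=> [[]|->].
pose S := [set e | exists b c, [/\ G0 b, K c & e = b `&` c]].
have SI : setI_closed S.
  move=> _ _ [b [c [Gb Kc ->]]] [b' [c' [Gb' Kc' ->]]].
  exists (b `&` b'), (c `&` c'); split; last by rewrite setIACA.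
    exact: set_algebraI (sigma_algebra_set_algebra a0) _ _.
  exact: set_algebraI (sigma_algebra_set_algebra aK) _ _.
have SQ : S `<=` Q.
  move=> _ [b [c [Gb Kc ->]]]; have mb := m0 _ Gb; have mc := mK _ Kc.
  split; first exact: measurableI.
  apply/espQ; first exact: measurableI.
  have key Y : version G2 a Y \/ version G0 a Y ->
      esp P (fun w => \1_(b `&` c) w * Y w) =
      fine (P c) * esp P (fun w => \1_b w * \1_a w).
    move=> vY; have [Y2m Y01] : field_measurable G2 Y /\ forall w, 0 <= Y w <= 1.
      by case: vY => -[YG Y01 _]; split => //; exact: field_measurable_sub YG.
    have bY : bounded_measurable G2 Y.
      by split => //; exists 1 => w; have /andP[? ?] := Y01 w; rewrite ger0_norm.
    have bbY : bounded_measurable G2 (fun w => \1_b w * Y w).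
      by apply: bounded_measurableM => //; apply: bounded_measurable_indic => //; exact: G02.
    have -> : esp P (fun w => \1_(b `&` c) w * Y w) =
              esp P (fun w => (\1_b w * Y w) * \1_c w).
      by apply: eq_esp => w; rewrite indicI /= mulrAC.
    rewrite (eq_esp_mul s2 (W' := fun=> fine (P c))) //.
    - under eq_esp do rewrite mulrC; rewrite espZ; last exact: bounded_measurable_sub bbY.
      by congr (_ * _); case: vY => -[_ _ ->] //; exact: G02.
    - by case: bbY.
    - move=> w; have /andP[Y0w Y1w] := Y01 w; rewrite indicE.
      by case: (w \in b); rewrite /= ?mul1r ?mul0r ?lexx ?ler01 ?Y0w.
    - exact: bmI.
    - move=> e G2e; have me := m2 _ G2e.
      under [RHS]eq_esp do rewrite mulrC; rewrite espZ; last exact: bmI.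
      under eq_esp do rewrite -[_ * _]/((\1_e \* \1_c) _) -indicI.
      rewrite !esp_indic //; last exact: measurableI.
      rewrite (ind _ _ G2e Kc) fineM ?fin_num_measure // mulrC //.
  by rewrite key; [rewrite key //; right|left].
have QT : Q setT by apply: SQ; exists setT, setT; split;
  [exact: set_algebraT (sigma_algebra_set_algebra a0)
  |exact: set_algebraT (sigma_algebra_set_algebra aK)|rewrite setIT].
have dQ : dynkin Q.
  split=> //.
    move=> e [me Qe]; have mce := measurableC me.
    split => //; apply/espQ => //; have {}Qe := (espQ _ me).1 Qe.
    have := (espQ _ measurableT).1 QT.2.
    have split_esp Y : bm Y -> esp P (fun w => \1_setT w * Y w) =
        esp P (fun w => \1_e w * Y w) + esp P (fun w => \1_(~` e) w * Y w).
      move=> bY; rewrite -espD; [|by apply: bmM => //; exact: bmI..].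
      apply: eq_esp => w; rewrite -mulrDl indicT !indicE in_setC.
      by case: (w \in e); rewrite /= ?addr0 ?add0r.
    by rewrite !split_esp // Qe => /addrI.
  move=> E tE QE; have mE k : measurable (E k) by case: (QE k).
  split; first exact: bigcup_measurable.
  have Y_ge0 Y G : version G a Y -> forall w, (0 <= (Y w)%:E)%E.
    by move=> [_ Y01 _] w; rewrite lee_fin; case/andP: (Y01 w).
  have mY Y : bm Y -> measurable_fun (\bigcup_k E k) (EFin \o Y).
    move=> [YG _]; apply: measurable_funTS; apply/measurable_EFinP.
    exact: field_measurable_measurable YG.
  rewrite !ge0_integral_bigcup //; try exact: mY.
  - by apply: eq_eseriesr => k _; case: (QE k).
  - by move=> w _; exact: Y_ge0 v0 _.
  - by move=> w _; exact: Y_ge0 v2 _.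
have sub : <<s S >> `<=` Q.
  by apply: lambda_system_subset => //; exact/dynkin_lambda_system.
have gS : generated P (G0 `|` K) `<=` <<s S >>.
  apply: smallest_sub; first exact: smallest_sigma_algebra.
  have G0S b : G0 b -> <<s S >> b.
    move=> Gb; apply: sub_sigma_algebra; exists b, setT; rewrite setIT; split => //.
    exact: set_algebraT (sigma_algebra_set_algebra aK).
  move=> c [[/G0S //|Kc]|/n0/G0S //]; apply: sub_sigma_algebra.
  exists setT, c; rewrite setTI; split => //.
  exact: set_algebraT (sigma_algebra_set_algebra a0).
by move=> e /gS/sub[me Qe]; exact/espQ.
Qed.

(** The case in view is G0 = F(A ∩ B), G1 = F(A), G2 = F(B), K = F(A minus B). First [Y2] is
    replaced by [Y0] against [Y1], then [Y1] by [Y0] against [Y0]. *)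
Lemma gram_versions (G0 G1 G2 K : set (set Om)) a Y0 Y1 Y2 :
  sub_sigma_field P G0 -> sub_sigma_field P G1 -> sub_sigma_field P G2 ->
  sub_sigma_field P K -> measurable a -> generated P (G0 `|` K) = G1 ->
  G0 `<=` G2 -> independent P G2 K ->
  version G0 a Y0 -> version G1 a Y1 -> version G2 a Y2 ->
  esp P (fun w => Y1 w * Y2 w) = esp P (fun w => Y0 w * Y0 w).
Proof.
move=> s0 s1 s2 sK ma gen G02 ind v0 v1 v2.
have bv G Y : sub_sigma_field P G -> version G a Y -> bm Y.
  by move=> sG vG; have [_ Gm _] := sG; exact: bounded_measurable_sub (bm_version sG vG).
have G01 : G0 `<=` G1 by rewrite -gen => b Gb; apply: sub_generated; left.
have [Y0G Y001 Y0E] := v0; have [Y1G Y101 Y1E] := v1.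
rewrite (eq_esp_mul s1 (W' := Y0)) //; [|exact: bv v2|exact: bv v0|]; last first.
  by rewrite -gen; exact: esp_version_generated v2.
under eq_esp do rewrite mulrC.
apply: (eq_esp_mul s0) => //; [exact: bv v1|exact: bv v0|].
by move=> e Ge; rewrite Y0E // Y1E //; exact: G01.
Qed.

Lemma esp_sqrB X Y : bm X -> bm Y ->
  esp P (fun w => (X w - Y w) * (X w - Y w)) =
  esp P (fun w => X w * X w) - 2 * esp P (fun w => X w * Y w)
    + esp P (fun w => Y w * Y w).
Proof.
move=> bX bY; rewrite -espZ; last exact: bmM.
rewrite -espB; [|exact: bmM|by apply: bmZ; exact: bmM].
rewrite -espD; [|by apply: bmB; [exact: bmM|apply: bmZ; exact: bmM]|exact: bmM].
by apply: eq_esp => w; ring.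
Qed.

(** For events this is the probability of the symmetric difference, written as a squared distance in
    L2. *)
Definition delta a b : R := esp P (fun w => (\1_a w - \1_b w) * (\1_a w - \1_b w)).

Lemma version_delta G a b Y : sub_sigma_field P G -> measurable a ->
  version G a Y -> G b ->
  esp P (fun w => \1_a w * \1_a w) - esp P (fun w => Y w * Y w) <= delta a b.
Proof.
move=> sG ma vY Gb; have [_ Gm _] := sG; have [YG Y01 YE] := vY.
have bY : bm Y := bounded_measurable_sub Gm (bm_version sG vY).
have bb : bm (\1_b : Om -> R) := bmI (Gm _ Gb).
have : 0 <= esp P (fun w => (Y w - \1_b w) * (Y w - \1_b w)).
  by apply: esp_ge0 => w; exact: sqr_ge0.
rewrite /delta !esp_sqrB //; last exact: bmI.
have -> : esp P (fun w => \1_a w * \1_b w) = esp P (fun w => Y w * \1_b w).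
  under eq_esp do rewrite mulrC; rewrite -YE //.
  by apply: eq_esp => w; rewrite mulrC.
lra.
Qed.

(** This is the closure of the union of the [G k] for the distance [delta]. *)
Definition approximable (G : nat -> set (set Om)) : set (set Om) :=
  [set e | measurable e /\ forall eps, 0 < eps ->
    exists k b, G k b /\ delta e b <= eps].

(** * Approximation by an increasing sequence of algebras *)

Section Approximation.
Variable G : nat -> set (set Om).
Hypotheses (G_alg : forall k, set_algebra (G k)) (G_meas : forall k, G k `<=` measurable).
Hypothesis G_incr : forall k, G k `<=` G k.+1.

Lemma delta_triangle a b c : measurable a -> measurable b -> measurable c ->
  delta a c <= delta a b + delta b c.
Proof.
move=> ma mb mc; have b2 x y : measurable x -> measurable y ->
    bm (fun w => (\1_x w - \1_y w) * (\1_x w - \1_y w) : R).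
  by move=> mx my; apply: bmM; apply: bmB; exact: bmI.
rewrite /delta -espD; [|exact: b2..]; apply: esp_le; first exact: b2.
  by apply: bounded_measurableD => //; exact: b2.
by move=> w; rewrite !indicE; case: (w \in a); case: (w \in b); case: (w \in c) => /=; lra.
Qed.

Lemma approximableU a b : approximable G a -> approximable G b -> approximable G (a `|` b).
Proof.
move=> [ma aP] [mb bP]; split; first exact: measurableU.
move=> eps eps0; have e20 : 0 < eps / 2 by rewrite divr_gt0.
have [k [a' [Ga' da]]] := aP _ e20; have [l [b' [Gb' db]]] := bP _ e20.
have Gle m n : (m <= n)%N -> G m `<=` G n.
  move=> /subnK <-; elim: (n - m)%N => //= i IH.
  by apply: subset_trans IH _; rewrite addSn; exact: G_incr.
exists (maxn k l), (a' `|` b'); split.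
  have [_ GU _] := G_alg (maxn k l); apply: GU.
    exact: Gle (leq_maxl k l) _ Ga'.
  exact: Gle (leq_maxr k l) _ Gb'.
have b2 x y : measurable x -> measurable y ->
    bm (fun w => (\1_x w - \1_y w) * (\1_x w - \1_y w) : R).
  by move=> mx my; apply: bmM; apply: bmB; exact: bmI.
have ma' := G_meas Ga'; have mb' := G_meas Gb'.
apply: (@le_trans _ _ (delta a a' + delta b b')); last by move: da db; lra.
rewrite /delta -espD; [|exact: b2..]; apply: esp_le.
- by apply: b2; exact: measurableU.
- by apply: bounded_measurableD => //; exact: b2.
move=> w; rewrite !indicE !in_setU.
by case: (w \in a); case: (w \in b); case: (w \in a'); case: (w \in b') => /=; lra.
Qed.

(** Finite partial unions are approximable and, by continuity from below, come arbitrarily close in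
    measure to the whole union. *)
Lemma approximable_bigcup (E : nat -> set Om) :
  (forall i, approximable G (E i)) -> approximable G (\bigcup_i E i).
Proof.
move=> EP; have mE i : measurable (E i) by case: (EP i).
have mUE : measurable (\bigcup_i E i) by exact: bigcup_measurable.
split => // eps eps0; have e20 : 0 < eps / 2 by rewrite divr_gt0.
pose F n := \bigcup_(i < n) E i.
have mF n : measurable (F n) by apply: bigcup_measurable.
have aF n : approximable G (F n).
  elim: n => [|n IH]; last first.
    by rewrite /F bigcup_mkord big_ord_recr /= -bigcup_mkord; exact: approximableU.
  rewrite /F bigcup_mkord big_ord0; split => // e e0; exists 0%N, set0.
  split; first by case: (G_alg 0%N).
  by rewrite /delta; under eq_esp do rewrite subrr mulr0; rewrite esp_cst ltW.
have UF : \bigcup_n F n = \bigcup_i E i.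
  apply/seteqP; split=> [w [n _ [i _ Ew]]|w [i _ Ew]]; first by exists i.
  by exists i.+1 => //; exists i => //=.
have FS n : F n `<=` \bigcup_i E i by rewrite -UF; exact: bigcup_sup.
have cvF : P (F n) @[n --> \oo] --> P (\bigcup_i E i).
  rewrite -UF; apply: nondecreasing_cvg_mu => //.
    by rewrite UF.
  by move=> m n mn; apply/subsetPset => w [i /= im Ew]; exists i => //=; exact: leq_trans mn.
have [N dN] : exists N, delta (\bigcup_i E i) (F N) <= eps / 2.
  have dE N : delta (\bigcup_i E i) (F N) = fine (P (\bigcup_i E i)) - fine (P (F N)).
    rewrite /delta -!(esp_indic P) // -espB; [|exact: bmI..].
    apply: eq_esp => w; rewrite !indicE.
    have [wF|wF] := boolP (w \in F N).
      by rewrite (mem_set (FS _ _ (set_mem wF))) subrr mulr0.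
    by case: (_ \in _); rewrite /= subr0 ?mulr1 ?mulr0.
  have /fine_cvgP[_ cv] : P (F n) @[n --> \oo] --> (fine (P (\bigcup_i E i)))%:E.
    by rewrite fineK // fin_num_measure.
  have /cvgrPdist_le/(_ _ e20)[N _ /(_ N (leqnn N)) /= dist] := cv.
  by exists N; rewrite dE; apply: le_trans (ler_norm _) dist.
have [_ /(_ _ e20)[k [b [Gb db]]]] := aF N.
exists k, b; split => //; have mb := G_meas Gb.
by apply: (le_trans (delta_triangle mUE (mF N) mb)); lra.
Qed.

Lemma approximable_sigma_algebra : sigma_algebra setT (approximable G).
Proof.
split; last exact: approximable_bigcup.
  split => // e e0; exists 0%N, set0; split; first by case: (G_alg 0%N).
  by rewrite /delta; under eq_esp do rewrite subrr mulr0; rewrite esp_cst ltW.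
move=> e [me eP]; rewrite setTD; split; first exact: measurableC.
move=> eps /eP[k [b [Gb db]]]; exists k, (~` b); split.
  by case: (G_alg k) => _ _; apply.
apply: le_trans db; rewrite le_eqVlt; apply/orP; left; apply/eqP.
apply: eq_esp => w; rewrite !indicE !in_setC.
by case: (w \in e); case: (w \in b) => /=; ring.
Qed.

Lemma approximable_generator k e : G k e -> approximable G e.
Proof.
move=> Ge; split; first exact: G_meas Ge.
move=> eps eps0; exists k, e; split => //.
by rewrite /delta; under eq_esp do rewrite subrr mulr0; rewrite esp_cst ltW.
Qed.

End Approximation.

End Versions.

(** * Limits in mean square *)

Section BoundedLimit.
Context {d : measure_display} {Om : measurableType d} {R : realType}.
Variable P : probability Om R.

Let ms := sigma_algebra_measurable Om.

(** Lets the upper limit stand in for a limit: bounds on the tail carry over even where convergence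
    is unknown. *)
Lemma limn_sup_dist (u : nat -> R) (x r : R) (k : nat) : bounded_fun u ->
  (forall l, (k <= l)%N -> `|x - u l| <= r) -> `|x - limn_sup u| <= r.
Proof.
move=> bu ur; have ul l : (k <= l)%N -> x - r <= u l <= x + r.
  by move=> /ur; rewrite ler_norml => /andP[? ?]; apply/andP; split; lra.
have [M [_ uM]] := bu; have {}uM l : `|u l| <= `|M| + 1.
  by apply: uM => //; rewrite (le_lt_trans (ler_norm _)) // ltrDl.
have ubd n : has_ubound (sdrop u n).
  by exists (`|M| + 1) => _ [l _ <-]; exact: le_trans (ler_norm _) (uM l).
have sups_ge n : x - r <= sups u n.
  have /andP[le1 _] := ul _ (leq_maxl k n); apply: (le_trans le1).
  by apply: ub_le_sup => //; exists (maxn k n) => //=; exact: leq_maxr.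
have sups_le : sups u k <= x + r.
  apply: ge_sup; first by exists (u k), k => /=.
  by move=> _ [l /= kl <-]; have /andP[] := ul _ kl.
have lb : lbound (range (sups u)) (x - r) by move=> _ [n _ <-].
have inf_ge : x - r <= inf (range (sups u)).
  by apply: lb_le_inf => //; exists (sups u 0%N), 0%N.
have inf_le : inf (range (sups u)) <= x + r.
  by apply: le_trans sups_le; apply: ge_inf; [exists (x - r)|exists k].
by rewrite limn_supE // ler_norml; apply/andP; split; lra.
Qed.

Lemma esp_norm_sqr (X : Om -> R) (c : R) : 0 < c -> bounded_measurable measurable X ->
  esp P (fun w => X w * X w) <= c ^+ 2 -> esp P (fun w => `|X w|) <= c.
Proof.
move=> c0 bX Xc.
have bXX : bounded_measurable measurable (fun w => X w * X w).
  exact: bounded_measurableM.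
have bN := bounded_measurable_norm bX.
(* AM-GM: |x| <= (x^2 / c + c) / 2 *)
apply: (@le_trans _ _ (esp P (fun w => (2 * c)^-1 * (X w * X w) + c / 2))).
  apply: esp_le => //.
    apply: bounded_measurableD => //; last exact: bounded_measurable_cst.
    exact: bounded_measurableZ.
  move=> w; rewrite -[X w * X w]/(X w ^+ 2) -real_normK ?num_real //.
  rewrite -subr_ge0 (_ : _ - _ = (2 * c)^-1 * (`|X w| - c) ^+ 2); last first.
    by field; rewrite gt_eqF.
  by rewrite mulr_ge0 ?sqr_ge0 // invr_ge0 mulr_ge0 // ltW.
rewrite espD; [|exact: bounded_measurableZ|exact: bounded_measurable_cst].
rewrite (espZ P _ bXX) esp_cst -[leRHS](@subrK _ (c / 2)) lerD2r.
rewrite mulrC ler_pdivrMr ?mulr_gt0 // (le_trans Xc) //.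
by rewrite le_eqVlt; apply/orP; left; apply/eqP; field.
Qed.

(** A subsequence has summable L1 gaps, its upper limit is [Z], and the bounds 0 and 1 turn L1
    closeness back into L2 closeness. *)
Lemma bounded_cauchy_limit (G : set (set Om)) (V : nat -> Om -> R) :
  sub_sigma_field P G -> (forall m, field_measurable G (V m)) ->
  (forall m w, 0 <= V m w <= 1) ->
  (forall e, 0 < e -> exists N, forall m n, (N <= m)%N -> (m <= n)%N ->
     esp P (fun w => (V m w - V n w) * (V m w - V n w)) <= e) ->
  exists Z, [/\ field_measurable G Z, forall w, 0 <= Z w <= 1 &
    forall e, 0 < e -> exists N, forall n, (N <= n)%N ->
      esp P (fun w => (V n w - Z w) * (V n w - Z w)) <= e].
Proof.
move=> [sG Gm _] VG V01 Vc.
have /choice[N NP] i : exists N, forall m n, (N <= m)%N -> (m <= n)%N ->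
    esp P (fun w => (V m w - V n w) * (V m w - V n w)) <= (2 ^- i.+1) ^+ 2.
  by apply: Vc; rewrite exprn_gt0 // invr_gt0 exprn_gt0.
(* Summing successors makes [phi] monotone and at least both [N i] and [i]. *)
pose phi i := (\sum_(j < i.+1) (N j).+1)%N.
have phi_le i : (phi i <= phi i.+1)%N by rewrite /phi [leqRHS]big_ord_recr /= leq_addr.
have N_phi i : (N i <= phi i)%N.
  by rewrite /phi big_ord_recr /= (leq_trans (leqnSn _)) // leq_addl.
have phi_ge i : (i <= phi i)%N.
  elim: i => // i IH; rewrite /phi big_ord_recr /= addnS ltnS.
  exact: leq_trans IH (leq_addr _ _).
pose W i := V (phi i); pose D i w := W i w - W i.+1 w.
have bV m : bounded_measurable measurable (V m).
  split; first exact: field_measurable_sub (VG m).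
  by exists 1 => w; have /andP[? ?] := V01 m w; rewrite ger0_norm.
have bD i : bounded_measurable measurable (D i).
  exact: (bounded_measurableB ms (bV _) (bV _)).
have bN i := bounded_measurable_norm (bD i).
have DE i : esp P (fun w => `|D i w|) <= 2 ^- i.+1.
  by apply: esp_norm_sqr => //; exact: NP.
(* The upper limit is defined and [G]-measurable everywhere, with no exceptional null set. *)
pose Z w := limn_sup (W ^~ w).
have Wb w : bounded_fun (W ^~ w).
  exists 1; split; first exact: num_real.
  move=> x x1 i _ /=; have /andP[? ?] := V01 (phi i) w.
  by rewrite ger0_norm // (le_trans _ (ltW x1)).
have ZG : field_measurable G Z.
  apply/(field_measurableP _ sG); apply: measurable_fun_limn_sup.
  - by move=> w _; exists 1 => _ [i _ <-]; case/andP: (V01 (phi i) w).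
  - by move=> w _; exists 0 => _ [i _ <-]; case/andP: (V01 (phi i) w).
  - by move=> i; exact: ((field_measurableP _ sG).1 (VG (phi i))).
have Z01 w : 0 <= Z w <= 1.
  have : `|2^-1 - Z w| <= 2^-1.
    apply: (@limn_sup_dist _ _ _ 0%N) => // l _.
    by have /andP[? ?] := V01 (phi l) w; rewrite /W ler_norml; apply/andP; split; lra.
  by rewrite ler_norml => /andP[? ?]; apply/andP; split; lra.
have bZ : bounded_measurable measurable Z.
  split; first exact: field_measurable_sub ZG.
  by exists 1 => w; have /andP[? ?] := Z01 w; rewrite ger0_norm.
(* Telescoping bound, in the extended reals since the series may diverge at some points; there it
   holds trivially. *)
have WZ k w : (`|W k w - Z w|%:E <= \sum_(0 <= j <oo) `|D (k + j)%N w|%:E)%E.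
  set S := (\sum_(0 <= j <oo) _)%E.
  have S0 : (0 <= S)%E by apply: nneseries_ge0 => j _ _; rewrite lee_fin.
  have [Sfin|] := boolP (S \is a fin_num); last first.
    by rewrite ge0_fin_numE // -leNgt leye_eq => /eqP ->; rewrite leey.
  rewrite -(fineK Sfin) lee_fin; apply: (@limn_sup_dist _ _ _ k) => // l kl.
  rewrite -lee_fin fineK //.
  have partial : (\sum_(0 <= j < l - k) `|D (k + j)%N w|%:E <= S)%E.
    by apply: nneseries_lim_ge => j _ _; rewrite lee_fin.
  apply: le_trans partial; rewrite sumEFin lee_fin -{1}(subnKC kl).
  elim: (l - k)%N => [|n IH]; first by rewrite addn0 subrr normr0 big_geq.
  rewrite big_nat_recr //= addnS; apply: le_trans (lerD IH (lexx _)).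
  by rewrite /D -(subrKA (W (k + n)%N w)) ler_normD.
have bWZ k := bounded_measurable_norm (bounded_measurableB ms (bV (phi k)) bZ).
have WZE k : esp P (fun w => `|W k w - Z w|) <= 2 ^- k.
  have mE X : bounded_measurable measurable X -> measurable_fun setT (EFin \o X).
    by move=> [mX _]; apply/measurable_EFinP; exact: field_measurable_measurable mX.
  rewrite -lee_fin -(esp_EFin P (bWZ k)).
  apply: (@le_trans _ _ (\int[P]_w (\sum_(0 <= j <oo) `|D (k + j)%N w|%:E))%E).
    apply: ge0_le_integral => //.
    - exact: mE (bWZ k).
    - apply: (ge0_emeasurable_sum (P := xpredT)).
        by move=> *; rewrite lee_fin.
      by move=> *; exact: mE.
    - by move=> w _; exact: WZ.
  rewrite integral_nneseries //; last by move=> j; exact: mE.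
  have e0 : 0 <= 2 ^- k :> R by rewrite invr_ge0 exprn_ge0.
  apply: le_trans (epsilon_trick0 xpredT e0); apply: lee_nneseries => [j _ _|j _].
    by apply: integral_ge0 => w _; rewrite lee_fin.
  rewrite esp_EFin // lee_fin (le_trans (DE _)) //.
  by rewrite -addnS exprD invfM natrX.
exists Z; split => // e e0.
have e40 : 0 < e / 4 by rewrite divr_gt0.
have [K1 K1P] := Vc _ e40.
have [K2 K2P] : exists k, 2 ^- k <= e / 4 :> R.
  have := near_infty_natSinv_lt (PosNum e40) => -[k _ /(_ k (leqnn k)) /= lt].
  exists k; apply: le_trans (ltW lt); rewrite lef_pV2 ?posrE ?exprn_gt0 //.
  by rewrite -natrX ler_nat; exact: ltn_expl.
exists K1 => n K1n; pose k := maxn n K2.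
have nphi : (n <= phi k)%N by rewrite (leq_trans _ (phi_ge k)) // leq_maxl.
have k2 : 2 ^- k <= e / 4 :> R.
  apply: le_trans K2P; rewrite lef_pV2 ?posrE ?exprn_gt0 //.
  by rewrite ler_weXn2l // ?ler1n // leq_maxr.
have bsq X Y : bounded_measurable measurable X -> bounded_measurable measurable Y ->
    bounded_measurable measurable (fun w : Om => (X w - Y w) * (X w - Y w) : R).
  by move=> bX bY; apply: bounded_measurableM => //; exact: bounded_measurableB.
(* The inequality (x - z)^2 <= 2 (x - y)^2 + 2 (y - z)^2 is used, the last square being at most its
   root as values lie in [0, 1]. Each expectation is at most e/4. *)
apply: (@le_trans _ _ (esp P (fun w =>
    2 * ((V n w - W k w) * (V n w - W k w)) + 2 * `|W k w - Z w|))).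
  apply: esp_le; first exact: bsq.
    apply: bounded_measurableD => //; apply: bounded_measurableZ => //.
      exact: (bsq _ _ (bV n) (bV (phi k))).
    exact: bWZ.
  move=> w; have /andP[Z0 Z1] := Z01 w; have := V01 (phi k) w.
  rewrite -/(W k) => /andP[W0 W1].
  have : (W k w - Z w) * (W k w - Z w) <= `|W k w - Z w|.
    rewrite -[leLHS]/((W k w - Z w) ^+ 2) -real_normK ?num_real // expr2.
    by rewrite ler_piMr // ler_norml; apply/andP; split; lra.
  move: (V n w) (W k w) (Z w) => x y z xy.
  have := sqr_ge0 (x + z - 2 * y); rewrite expr2; nra.
rewrite espD; first last.
- exact: (bounded_measurableZ ms 2 (bWZ k)).
- exact: (bounded_measurableZ ms 2 (bsq _ _ (bV n) (bV (phi k)))).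
rewrite (espZ P _ (bsq _ _ (bV n) (bV (phi k)))) (espZ P _ (bWZ k)).
have := K1P _ _ K1n nphi; have := WZE k; rewrite -/(W k); move: k2; lra.
Qed.

End BoundedLimit.

(** * The L2 norm of bounded functions *)

Section L2norms.
Context {d : measure_display} {Om : measurableType d} {R : realType}.
Variable P : probability Om R.
Implicit Types X Y : Om -> R.

Local Notation bm := (bounded_measurable (@measurable _ Om)).

Let ms := sigma_algebra_measurable Om.

Lemma L2normE X : bm X -> L2norm P X = (Num.sqrt (esp P (fun w => X w * X w)))%:E.
Proof.
move=> bX; rewrite /L2norm unlock.
have -> : (\int[P]_w (`|(EFin \o X) w| `^ 2))%E = (esp P (fun w => X w * X w))%:E.
  rewrite -esp_EFin; last exact: bounded_measurableM.
  apply: eq_integral => w _; rewrite [(`|_|)%E](_ : _ = `|X w|%:E) // poweR_EFin powR_mulrn //.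
  by rewrite real_normK ?num_real // expr2.
by rewrite poweR_EFin powR12_sqrt // esp_ge0 // => w; exact: sqr_ge0.
Qed.

Lemma L2norm_le X e : bm X -> 0 <= e -> esp P (fun w => X w * X w) <= e ^+ 2 ->
  (L2norm P X <= e%:E)%E.
Proof.
move=> bX e0 Xe; rewrite L2normE // lee_fin.
by rewrite (le_trans (ler_wsqrtr Xe)) // sqrtr_sqr ger0_norm.
Qed.

Lemma ae_eq_L2norm X Y : measurable_fun setT X -> measurable_fun setT Y ->
  {ae P, forall w, X w = Y w} -> L2norm P X = L2norm P Y.
Proof.
move=> mX mY XY; rewrite /L2norm unlock; congr (_ `^ _)%E.
have mpow (Z : Om -> R) : measurable_fun setT Z ->
    measurable_fun setT (fun w => (`|(EFin \o Z) w| `^ 2)%E).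
  move=> mZ; apply: (@measurableT_comp _ _ _ _ _ _ (fun x : \bar R => (x `^ 2)%E)).
    exact: measurable_poweR.
  by apply: measurableT_comp => //; exact/measurable_EFinP.
apply: ae_eq_integral => //; [exact: mpow|exact: mpow|].
by apply: filterS XY => w XYw _ /=; rewrite XYw.
Qed.

Lemma L2normD X Y : measurable_fun setT X -> measurable_fun setT Y ->
  (L2norm P (fun w => X w + Y w)%R <= L2norm P X + L2norm P Y)%E.
Proof. by move=> mX mY; apply: minkowski_EFin => //; rewrite ler1n. Qed.

Lemma bounded_measurable_L2 (G : set (set Om)) X : G `<=` measurable ->
  bounded_measurable G X -> L2 P G X.
Proof.
move=> Gm bX; have bX' := bounded_measurable_sub Gm bX.
split; last by case: bX.
rewrite inE; apply/andP; split; rewrite inE /=.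
  exact: field_measurable_measurable (bX'.1).
by rewrite /finite_norm -[X in (X < _)%E]/(L2norm P X) L2normE // ltry.
Qed.

Lemma L2norm_cvg0 (I : Type) (Fl : set_system I) {FF : Filter Fl} (f : I -> Om -> R) :
  (forall e : R, 0 < e -> \forall i \near Fl, (L2norm P (f i) <= e%:E)%E) ->
  L2norm P (f i) @[i --> Fl] --> 0%E.
Proof.
move=> fe; apply/fine_cvgP; split.
  apply: filterS (fe _ ltr01) => i le1.
  by rewrite ge0_fin_numE ?Lnorm_ge0 // (le_lt_trans le1) ?ltry.
apply/cvgrPdist_le => e e0; apply: filterS (fe _ e0) => i lee.
have n0 : (0 <= L2norm P (f i))%E by exact: Lnorm_ge0.
rewrite sub0r normrN ger0_norm ?fine_ge0 // -lee_fin /= fineK //.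
by rewrite ge0_fin_numE // (le_lt_trans lee) ?ltry.
Qed.

End L2norms.

(** * Stability of indicators *)

Lemma avg_bounded_measurable {d : measure_display} {Om : measurableType d}
    {R : realType} {T : Type} (B : set (set T)) (p : R) (Y : set T -> Om -> R)
    (G : set (set Om)) :
  set_algebra B -> finite_set B -> sigma_algebra setT G ->
  (forall A, B A -> bounded_measurable G (Y A)) ->
  bounded_measurable G (fun w => avg B p (fun A => Y A w)).
Proof.
move=> Ba Bf sG bY; have [K [pi [pis E]]] := finite_algebra_fibers Ba Bf.
rewrite E; under eq_fun do rewrite avg_fibers //.
apply: bounded_measurable_sum => // I; apply: bounded_measurableZ => //.
by apply: bY; rewrite E; exists I.
Qed.

Lemma esp_avg_mul {d : measure_display} {Om : measurableType d}
    {R : realType} (P : probability Om R) {T : Type} (B : set (set T)) (p : R)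
    (Y : set T -> Om -> R) (Z : Om -> R) :
  set_algebra B -> finite_set B ->
  (forall A, B A -> bounded_measurable measurable (Y A)) ->
  bounded_measurable measurable Z ->
  esp P (fun w => avg B p (fun A => Y A w) * Z w) =
  avg B p (fun A => esp P (fun w => Y A w * Z w)).
Proof.
move=> Ba Bf bY bZ; have [K [pi [pis E]]] := finite_algebra_fibers Ba Bf.
have sm := sigma_algebra_measurable Om.
have bYI I : bounded_measurable measurable (fun w => Y (fiber pi I) w * Z w).
  by apply: bounded_measurableM => //; apply: bY; rewrite E; exists I.
rewrite E avg_fibers //; under eq_esp do rewrite avg_fibers // mulr_suml.
rewrite esp_sum => [|I].
  apply: eq_bigr => I _; under eq_esp do rewrite -mulrA.
  by rewrite espZ.
by under eq_fun do rewrite -mulrA; exact: bounded_measurableZ.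
Qed.

(** For [p = expR (- t)] this is an everywhere bounded representative of [Uapprox] applied to the
    indicator. *)
Definition mean_version {d : measure_display} {Om : measurableType d}
    {R : realType} {T : Type} (Y : set T -> Om -> R) (B : set (set T)) (p : R)
    (w : Om) : R := avg B p (fun A => Y A w).

(** This is f(A), the mass of the event that M is contained in [A]. *)
Definition spectral_mass {d : measure_display} {Om : measurableType d}
    {R : realType} (P : probability Om R) {T : Type} (Y : set T -> Om -> R)
    (A : set T) : R := esp P (fun w => Y A w * Y A w).

(** * The spectral mass of an event *)

Section Noise.
Context {R : realType} {d : measure_display} {Om : measurableType d}.
Variable P : probability Om R.
Context {T : Type} {Alg : set (set T)} {F : set T -> set (set Om)}.
Hypotheses (Alg_algebra : set_algebra Alg)
  (F_field : forall A, Alg A -> sub_sigma_field P (F A))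
  (F_indep : forall A B, Alg A -> Alg B -> A `&` B = set0 ->
     independent P (F A) (F B))
  (F_gen : forall A B, Alg A -> Alg B -> A `&` B = set0 ->
     generated P (F A `|` F B) = F (A `|` B)).

Lemma noise_le A B : Alg A -> Alg B -> A `<=` B -> F A `<=` F B.
Proof.
move=> AA AB sAB; have ABA : Alg (B `\` A) by exact: set_algebraD.
have AB0 : A `&` (B `\` A) = set0 by rewrite setIDA setIC -setIDA setDv setI0.
have := F_gen AA ABA AB0; rewrite setDUK // => <- b Fb.
by apply: sub_generated; left.
Qed.

Let AlgT : Alg setT := set_algebraT Alg_algebra.

Let Fm A : Alg A -> F A `<=` measurable.
Proof. by move=> /F_field[]. Qed.

Section Event.
Context {a : set Om}.
Hypothesis Fa : F setT a.
Let ma : measurable a := Fm AlgT Fa.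

(** The version for the whole space is chosen to be the indicator itself, so later identities at
    [setT] hold exactly and not only almost everywhere. *)
Lemma versions_exist : exists Y : set T -> Om -> R,
  (forall A, Alg A -> version P (F A) a (Y A)) /\ Y setT = \1_a.
Proof.
have /choice[Y0 Y0P] (A : set T) : exists Y, Alg A -> version P (F A) a Y.
  have [/F_field sA|nA] := pselect (Alg A); last by exists (fun=> 0).
  by have [Y vY] := version_exists sA ma; exists Y.
exists (fun A => if pselect (A = setT) then \1_a else Y0 A); split; last first.
  by case: (pselect ([set: T] = setT)).
move=> A AA; case: (pselect (A = setT)) => [AT|nAT]; last exact: Y0P.
have FAa : F A a by rewrite AT.
split => //.
  have [sA _ _] := F_field AA.
  by have [] := bounded_measurable_indic (R := R) sA FAa.
by move=> w /=; rewrite indicE; case: (w \in a); rewrite ?lexx ler01.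
Qed.

Section Spectrum.
Context {Y : set T -> Om -> R}.
Hypotheses (Y_version : forall A, Alg A -> version P (F A) a (Y A))
  (YT : Y setT = \1_a).

Let ms := sigma_algebra_measurable Om.

Lemma bm_versions A : Alg A -> bounded_measurable measurable (Y A).
Proof.
move=> AA; apply: (bounded_measurable_sub (Fm AA)).
exact: bm_version (F_field AA) (Y_version AA).
Qed.

Local Notation spectral := (spectral_mass P Y).

(** The projections satisfy E_A E_B = E_(A ∩ B), because [A] splits into its intersection with [B]
    and a part independent of [B]. *)
Lemma esp_versions A B : Alg A -> Alg B ->
  esp P (fun w => Y A w * Y B w) = spectral (A `&` B).
Proof.
move=> AA AB; have AAB : Alg (A `&` B) by exact: set_algebraI.
have ADB : Alg (A `\` B) by exact: set_algebraD.
apply: (@gram_versions _ _ _ P (F (A `&` B)) (F A) (F B) (F (A `\` B)) a);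
  try exact: F_field; try exact: Y_version; rewrite ?F_gen //.
- by rewrite setUIDK.
- by rewrite setDE setIACA setICr setI0.
- by apply: noise_le => //; exact: subIsetr.
- by apply: F_indep => //; rewrite setDE setICA setICr setI0.
Qed.

Lemma spectral_mass_gram_positive : gram_positive Alg spectral.
Proof.
move=> K pi piAlg c.
pose V w := \sum_(I : {set K}) c I * Y (fiber pi I) w.
have bI I : bounded_measurable measurable (fun w => c I * Y (fiber pi I) w).
  by apply: bounded_measurableZ => //; exact: bm_versions.
have bV : bounded_measurable measurable V by exact: bounded_measurable_sum.
suff -> : \sum_(I : {set K}) \sum_(J : {set K})
    c I * c J * spectral (fiber pi (I :&: J)) = esp P (fun w => V w * V w).
  by apply: esp_ge0 => w; exact: sqr_ge0.
rewrite {1}/V; under [RHS]eq_esp do rewrite mulr_suml.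
rewrite esp_sum => [|I]; last exact: bounded_measurableM.
apply: eq_bigr => I _; rewrite /V; under [RHS]eq_esp do rewrite mulr_sumr.
rewrite esp_sum => [|J]; last exact: bounded_measurableM.
apply: eq_bigr => J _; rewrite fiberI -esp_versions // -espZ; last first.
  by apply: bounded_measurableM => //; exact: bm_versions.
by apply: eq_esp => w; rewrite mulrACA.
Qed.

Lemma spectral_mass_setT_le1 : spectral setT <= 1.
Proof.
rewrite -(esp_cst P 1); apply: esp_le.
- by apply: bounded_measurableM => //; exact: bm_versions.
- exact: bounded_measurable_cst.
- by move=> w; rewrite YT indicE; case: (_ \in _); rewrite /= ?mulr1 ?mulr0 ?ler01.
Qed.

Hypothesis F_cont : forall A : nat -> set T,
  (forall k, Alg (A k)) -> (forall k, A k `<=` A k.+1) ->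
  generated P (generated P (\bigcup_k F (A k)) `|` \bigcap_k F (~` A k)) = F setT.

(** The approximable events form a sigma-field containing F(T), hence [a]; a nearby event [b] then
    bounds the loss through [version_delta]. *)
Lemma spectral_mass_continuous (A : nat -> set T) :
  (forall k, Alg (A k)) -> (forall k, A k `<=` A k.+1) ->
  forall e, 0 < e -> exists k, forall n, (k <= n)%N ->
    spectral setT - spectral (A k `|` ~` A n) <= e.
Proof.
move=> AA Ainc e e0; have [_ AlgU AlgC] := Alg_algebra.
have AlgK k n : Alg (A k `|` ~` A n) by apply: AlgU => //; exact: AlgC.
(* Requiring membership for all [n] at once makes one approximating event serve uniformly in [n].
   The remote field already lies in [G 0]. *)
pose G k := [set b | forall n, (k <= n)%N -> F (A k `|` ~` A n) b].
have Galg k : set_algebra (G k).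
  have FA n := sigma_algebra_set_algebra (let: And3 s _ _ := F_field (AlgK k n) in s).
  split=> [n _|b c Gb Gc n kn|b Gb n kn]; first by have [] := FA n.
  - by have [_ FU _] := FA n; apply: FU; [exact: Gb|exact: Gc].
  - by have [_ _ FC] := FA n; apply: FC; exact: Gb.
have Gm k : G k `<=` measurable by move=> b /(_ k (leqnn k)); apply: Fm.
have Ginc k : G k `<=` G k.+1.
  move=> b Gb n kn; apply: noise_le (Gb _ (ltnW kn)) => //.
  by apply: setSU; exact: Ainc.
have GF k : F (A k) `<=` G k.
  by move=> b Fb n _; apply: noise_le Fb => //; exact: subsetUl.
have aS := approximable_sigma_algebra P Galg Gm Ginc.
have nA b : null_sets P b -> approximable P G b.
  move=> nb; apply: (approximable_generator P Gm (k := 0%N)) => n _.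
  by have [_ _] := F_field (AlgK 0%N n); apply.
have [_ aP] : approximable P G a.
  have : F setT `<=` approximable P G; last exact.
  rewrite -(F_cont AA Ainc); apply: smallest_sub => // b [[gb|ib]|/nA//].
    move: b gb; apply: smallest_sub => // b [[k _ /GF Gb]|/nA//].
    exact: (approximable_generator P Gm Gb).
  apply: (approximable_generator P Gm (k := 0%N)) => n _.
  by apply: noise_le (ib n I); [exact: AlgC|exact: AlgK|exact: subsetUr].
have [k [b [Gb db]]] := aP _ e0.
exists k => n kn; apply: le_trans db.
rewrite {1}/spectral_mass YT.
exact: version_delta (F_field _) ma (Y_version _) (Gb n kn).
Qed.

Section Levels.
Context {AA : nat -> set (set T)} (AA_exh : exhaustion AA Alg).
Context {p : R} (p01 : 0 <= p <= 1).

Let AAa := exhaustion_algebra AA_exh.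
Let AAf := exhaustion_finite AA_exh.
Let AA_Alg m A : AA m A -> Alg A.
Proof. exact: exhaustion_sub. Qed.

Definition level_gram m n : R :=
  avg (AA m) p (fun A => avg (AA n) p (fun A' => spectral (A' `&` A))).

Lemma mean_version_bounds m w : 0 <= mean_version Y (AA m) p w <= 1.
Proof.
have Y01 A : AA m A -> 0 <= Y A w <= 1 by move=> /AA_Alg/Y_version[].
rewrite -{1}(avg_cst (AAa m) (AAf m) p 0) -(avg_cst (AAa m) (AAf m) p 1).
by apply/andP; split; apply: avg_ler => // A /Y01/andP[].
Qed.

Lemma mean_version_measurable m : bounded_measurable (F setT) (mean_version Y (AA m) p).
Proof.
have [sT _ _] := F_field AlgT.
apply: avg_bounded_measurable => // A /AA_Alg AlgA.
apply: (bounded_measurable_sub (noise_le AlgA AlgT (@subsetT _ _))).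
exact: bm_version (F_field AlgA) (Y_version AlgA).
Qed.

Let bml m : bounded_measurable measurable (mean_version Y (AA m) p).
Proof. exact: bounded_measurable_sub (Fm AlgT) (mean_version_measurable m). Qed.

Lemma esp_mean_version A n : Alg A ->
  esp P (fun w => mean_version Y (AA n) p w * Y A w) =
  avg (AA n) p (fun A' => spectral (A' `&` A)).
Proof.
move=> AlgA; rewrite /mean_version esp_avg_mul //; last exact: bm_versions.
  by apply: eq_avg => A' /AA_Alg AlgA'; rewrite esp_versions.
by move=> A' /AA_Alg; exact: bm_versions.
Qed.

Lemma esp_level_gram m n :
  esp P (fun w => mean_version Y (AA m) p w * mean_version Y (AA n) p w) =
  level_gram m n.
Proof.
rewrite {1}/mean_version esp_avg_mul //; last by move=> A /AA_Alg; exact: bm_versions.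
apply: eq_avg => A /AA_Alg AlgA; under eq_esp do rewrite mulrC.
exact: esp_mean_version.
Qed.

(** Expanding the square gives f(T) minus twice the average of f plus [level_gram m m], and the last
    term is at most that average since f is monotone. *)
Lemma mean_version_dist m :
  esp P (fun w => (\1_a w - mean_version Y (AA m) p w) *
                  (\1_a w - mean_version Y (AA m) p w)) <=
  miss spectral (AA m) p setT.
Proof.
have bT : bounded_measurable measurable (\1_a : Om -> R) by rewrite -YT; exact: bm_versions.
rewrite esp_sqrB // esp_level_gram.
have -> : esp P (fun w => \1_a w * mean_version Y (AA m) p w) = avg (AA m) p spectral.
  under eq_esp do rewrite mulrC; rewrite -YT esp_mean_version //.
  by apply: eq_avg => A _; rewrite setIT.
have -> : esp P (fun w => \1_a w * \1_a w) = spectral setT by rewrite /spectral_mass YT.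
have -> : miss spectral (AA m) p setT = spectral setT - avg (AA m) p spectral.
  rewrite (missE AA_exh); congr (_ - _).
  by apply: eq_avg => A _; rewrite setCT setU0.
suff : level_gram m m <= avg (AA m) p spectral by lra.
apply: avg_ler => // A mA; have AlgA := AA_Alg mA.
rewrite -(avg_cst (AAa m) (AAf m) p (spectral A)).
apply: avg_ler => // A' /AA_Alg AlgA'.
apply: (gram_positive_le AA_exh spectral_mass_gram_positive) => //.
exact: set_algebraI.
Qed.

Lemma level_gram_le m n : (m <= n)%N ->
  level_gram n n <= level_gram m n <= level_gram m m.
Proof.
move=> mn; have AAle := exhaustion_le AA_exh mn; apply/andP; split.
  have -> : level_gram m n =
      avg (AA n) p (fun A => avg (AA m) p (fun A' => spectral (A' `&` A))).
    rewrite /level_gram avg_exchange //.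
    by apply: eq_avg => A _; apply: eq_avg => A' _; rewrite setIC.
  apply: avg_ler => // A nA.
  exact: (avg_setI_le AA_exh spectral_mass_gram_positive).
apply: avg_ler => // A mA.
by apply: (avg_setI_le AA_exh spectral_mass_gram_positive) => //; exact: AAle.
Qed.

(** The squared distance is at most [level_gram m m - level_gram n n], the drop of a nonincreasing
    sequence bounded below; [N] is taken where that sequence is within [e] of its infimum. *)
Lemma mean_version_cauchy e : 0 < e -> exists N, forall m n, (N <= m)%N -> (m <= n)%N ->
  esp P (fun w => (mean_version Y (AA m) p w - mean_version Y (AA n) p w) *
                  (mean_version Y (AA m) p w - mean_version Y (AA n) p w))
  <= e.
Proof.
move=> e0; pose S := range (fun m => level_gram m m).
have lbS : lbound S 0.
  move=> _ [m _ <-]; rewrite -esp_level_gram.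
  by apply: esp_ge0 => w; exact: sqr_ge0.
have infS : has_inf S by split; [exists (level_gram 0 0), 0%N|exists 0].
have [_ [N _ <-] NS] := inf_adherent e0 infS.
exists N => m n Nm mn; rewrite esp_sqrB // !esp_level_gram.
have /andP[nm _] := level_gram_le mn.
have /andP[le1 le2] := level_gram_le Nm.
have : inf S <= level_gram n n by apply: ge_inf; [exists 0|exists n].
by move: NS le1 le2 nm; rewrite /S; lra.
Qed.

End Levels.

End Spectrum.

Hypothesis F_cont : forall A : nat -> set T,
  (forall k, Alg (A k)) -> (forall k, A k `<=` A k.+1) ->
  generated P (generated P (\bigcup_k F (A k)) `|` \bigcap_k F (~` A k)) = F setT.

(** * The semigroup applied to an indicator *)

Section Semigroup.
Context {AA : nat -> set (set T)} (AA_exh : exhaustion AA Alg).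
Context {Y : set T -> Om -> R}.
Hypotheses (Y_version : forall A, Alg A -> version P (F A) a (Y A))
  (YT : Y setT = \1_a).

Local Notation X := (\1_a : Om -> R).

Let AAa := exhaustion_algebra AA_exh.
Let AAf := exhaustion_finite AA_exh.
Let FTm := Fm AlgT.
Let ms := sigma_algebra_measurable Om.

Lemma Uapprox_measurable m t : measurable_fun setT (Uapprox P F AA m t X).
Proof.
have [K [pi [pis E]]] := finite_algebra_fibers (AAa m) (AAf m).
have -> : Uapprox P F AA m t X = (fun w => \sum_(I : {set K})
    expR (- t) ^+ #|I| * (1 - expR (- t)) ^+ (#|K| - #|I|)
      * cond_exp P (F (fiber pi I)) X w).
  apply/funext => w.
  rewrite -(avg_fibers (expR (- t)) (fun A => cond_exp P (F A) X w) pis) -E.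
  by [].
apply: measurable_sum => I; apply: measurable_funM; first exact: measurable_cst.
have AI : Alg (fiber pi I) by apply: (exhaustion_sub AA_exh (m := m)); rewrite E; exists I.
have [cG _] := cond_exp_version (F_field AI) ma (Y_version AI).
exact: field_measurable_measurable (Fm AI) cG.
Qed.

(** A level has finitely many members, so one null set serves all their conditional expectations. *)
Lemma Uapprox_ae m t :
  {ae P, forall w, Uapprox P F AA m t X w = mean_version Y (AA m) (expR (- t)) w}.
Proof.
have [K [pi [pis E]]] := finite_algebra_fibers (AAa m) (AAf m).
have : {ae P, forall w, forall I : {set K},
    cond_exp P (F (fiber pi I)) X w = Y (fiber pi I) w}.
  apply: filter_forall => I.
  have AI : Alg (fiber pi I) by apply: (exhaustion_sub AA_exh (m := m)); rewrite E; exists I.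
  by have [_] := cond_exp_version (F_field AI) ma (Y_version AI).
apply: filterS => w wE; rewrite /mean_version.
transitivity (avg (AA m) (expR (- t)) (fun A => cond_exp P (F A) X w)); first by [].
by rewrite E !avg_fibers //; apply: eq_bigr => I _; rewrite wE.
Qed.

Let p01 (t : R) : 0 < t -> 0 <= expR (- t) <= 1.
Proof. by move=> t0; rewrite expR_ge0 -expR0 ler_expR oppr_le0 ltW. Qed.

(** The limit exists, so the choice defining [Ulim] does not fall back on its default value. *)
Lemma Ulim_spec t : 0 < t -> L2 P (F setT) (Ulim P F AA t X) /\
  L2norm P (fun w => Uapprox P F AA m t X w - Ulim P F AA t X w) @[m --> \oo] --> 0%E.
Proof.
move=> t0; apply: (@xgetPex _ _ [set Z | L2 P (F setT) Z /\
  L2norm P (fun w => Uapprox P F AA m t X w - Z w) @[m --> \oo] --> 0%E]).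
pose V m := mean_version Y (AA m) (expR (- t)).
have bV m : bounded_measurable (F setT) (V m).
  exact: (mean_version_measurable Y_version AA_exh).
have V01 m w : 0 <= V m w <= 1 by exact: (mean_version_bounds Y_version AA_exh (p01 t0)).
have Vc := mean_version_cauchy Y_version AA_exh (p01 t0).
have [Z [ZG Z01 Zlim]] := bounded_cauchy_limit (F_field AlgT) (fun m => (bV m).1) V01 Vc.
have bZ : bounded_measurable (F setT) Z.
  by split => //; exists 1 => w; have /andP[? ?] := Z01 w; rewrite ger0_norm.
exists Z; split; first exact: bounded_measurable_L2 FTm bZ.
have bVZ m : bounded_measurable measurable (fun w => V m w - Z w).
  apply: (bounded_measurable_sub FTm).
  by apply: bounded_measurableB => //; have [] := F_field AlgT.
apply: L2norm_cvg0 => e e0; have e20 : 0 < e ^+ 2 by rewrite exprn_gt0.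
have [N NP] := Zlim _ e20; exists N => // m /= Nm.
rewrite (@ae_eq_L2norm _ _ _ _ _ (fun w => V m w - Z w)).
- by apply: L2norm_le (ltW e0) (NP _ Nm).
- apply: measurable_funB; first exact: Uapprox_measurable.
  exact: field_measurable_measurable FTm ZG.
- exact: field_measurable_measurable (@subset_refl _ _) (bVZ m).1.
- by apply: filterS (Uapprox_ae m t) => w ->.
Qed.

(** As the bound on [miss] is uniform in the level, any level close to the limit can be inserted in
    the triangle inequality; each part contributes [e]. *)
Lemma Ulim_dist t e : 0 < t -> 0 < e ->
  (forall m, miss (spectral_mass P Y) (AA m) (expR (- t)) setT <= e ^+ 2) ->
  (L2norm P (fun w => (X w - Ulim P F AA t X w)%R) <= (2 * e)%:E)%E.
Proof.
move=> t0 e0 misse; have [[UL UG] Ucvg] := Ulim_spec t0.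
have mX : measurable_fun setT X by exact: measurable_indic.
have mU : measurable_fun setT (Ulim P F AA t X).
  exact: field_measurable_measurable UG.
have [m Um] : exists m,
    (L2norm P (fun w => (Uapprox P F AA m t X w - Ulim P F AA t X w)%R) <= e%:E)%E.
  have /fine_cvgP[[N1 _ fin] /cvgrPdist_le/(_ _ e0)[N2 _ cv]] := Ucvg.
  exists (maxn N1 N2); rewrite -(fineK (fin _ (leq_maxl N1 N2))) lee_fin.
  have := cv _ (leq_maxr N1 N2); rewrite /= sub0r normrN.
  exact: le_trans (ler_norm _).
have mUa := Uapprox_measurable m t.
have -> : (fun w => X w - Ulim P F AA t X w) =
   (fun w => (X w - Uapprox P F AA m t X w) +
     (Uapprox P F AA m t X w - Ulim P F AA t X w)).
  by apply/funext => w; rewrite addrA subrK.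
apply: (le_trans (L2normD P (measurable_funB mX mUa) (measurable_funB mUa mU))).
rewrite mulr_natl mulr2n EFinD; apply: leeD => //.
have bV : bounded_measurable (F setT) (mean_version Y (AA m) (expR (- t))).
  exact: (mean_version_measurable Y_version AA_exh).
have bXV : bounded_measurable measurable
    (fun w => X w - mean_version Y (AA m) (expR (- t)) w).
  apply: bounded_measurableB => //; last exact: bounded_measurable_sub bV.
  exact: bounded_measurable_indic.
rewrite (ae_eq_L2norm (Y := fun w =>
    X w - mean_version Y (AA m) (expR (- t)) w)).
- apply: L2norm_le (ltW e0) _ => //; apply: le_trans (misse m).
  exact: (mean_version_dist Y_version YT AA_exh (p01 t0)).
- exact: measurable_funB.
- exact: field_measurable_measurable (@subset_refl _ _) bXV.1.
- by apply: filterS (Uapprox_ae m t) => w /= ->.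
Qed.

End Semigroup.

Lemma indicator_stable (AA : nat -> set (set T)) : exhaustion AA Alg ->
  stable P F AA \1_a.
Proof.
move=> AA_exh; have [Y [Y_version YT]] := versions_exist.
have fpos := spectral_mass_gram_positive Y_version.
have fT := spectral_mass_setT_le1 Y_version YT.
have fcont := spectral_mass_continuous Y_version YT F_cont.
have stab := uniform_stability Alg_algebra AA_exh fpos fT fcont.
split.
  apply: bounded_measurable_L2; first exact: Fm.
  by apply: bounded_measurable_indic => //; have [] := F_field AlgT.
apply: L2norm_cvg0 => e e0.
have e20 : 0 < e / 2 by rewrite divr_gt0.
have [|p [/andP[p0 p1] pm]] := stab ((e / 2) ^+ 2); first by rewrite exprn_gt0.
have p10 : 0 < 1 - p by rewrite subr_gt0.
near=> t.
have t0 : 0 < t by near: t; exact: nbhs_right_gt.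
have tp : t <= 1 - p by near: t; exact: nbhs_right_le.
(* This uses 1 - t <= exp(-t). *)
have pt : p <= expR (- t) by rewrite (le_trans _ (expR_ge1Dx _)) //; lra.
rewrite [e](_ : _ = 2 * (e / 2)); last by field.
apply: (Ulim_dist AA_exh Y_version YT t0 e20) => m.
apply: le_trans (pm m); apply: (miss_antitone AA_exh fpos) => //.
by rewrite -expR0 ler_expR oppr_le0 ltW.
Unshelve. all: by end_near.
Qed.

End Event.
End Noise.

Theorem theorem3p2 (R : realType) (d : measure_display)
    (Om : measurableType d) (P : probability Om R)
    (T : Type) (Alg : set (set T)) (F : set T -> set (set Om))
    (Alg_algebra : set_algebra Alg)
    (Alg_countable : countable Alg)
    (F_field : forall A, Alg A -> sub_sigma_field P (F A))
    (F_indep : forall A B, Alg A -> Alg B -> A `&` B = set0 ->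
       independent P (F A) (F B))
    (F_gen : forall A B, Alg A -> Alg B -> A `&` B = set0 ->
       generated P (F A `|` F B) = F (A `|` B))
    (F_cont : forall A : nat -> set T,
       (forall k, Alg (A k)) -> (forall k, A k `<=` A k.+1) ->
       generated P (generated P (\bigcup_k F (A k))
                    `|` \bigcap_k F (~` A k)) = F setT)
    (AA : nat -> set (set T))
    (AA_exhaustion : exhaustion AA Alg) :
  F setT = stable_field P F AA.
Proof.
have AlgT : Alg setT by exact: set_algebraT.
apply/seteqP; split=> [a Fa|].
  rewrite /stable_field; apply: sub_generated; exists \1_a.
    exact: (indicator_stable Alg_algebra F_field F_indep F_gen Fa F_cont).
  (* The event is recovered as the preimage of 1 under its stable indicator. *)
  exists [set 1] => //; rewrite setTI; apply/seteqP; split=> w /=; rewrite indicE.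
    have [/set_mem //|_ /esym/eqP] := boolP (w \in a).
    by rewrite oner_eq0.
  by move=> wa; rewrite mem_set.
(* Conversely, stable functions are measurable for F(T) by definition. *)
rewrite /stable_field; apply: generated_sub; first exact: F_field.
by move=> A [X [[_ XG] _]]; exact: XG.
Qed.
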